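(* There is a parametric family of $\mathcal{R}$-extensions over $\mathbb{Q}$, where $\mathcal{R}$ is the Rubik's Cube group. That is, there exist an integer $n\ge 1$ and, for independent indeterminates (parameters) $t_1,\dots,t_n$ over $\mathbb{Q}$, a finite Galois extension of the rational function field $\mathbb{Q}(t_1,\dots,t_n)$ whose Galois group over $\mathbb{Q}(t_1,\dots,t_n)$ is isomorphic to $\mathcal{R}$.
   Context: A parametric family of Galois extensions with group $G$ (a parametric family of $G$-extensions over $\mathbb{Q}$) is a family of field extensions depending on some parameters $t_1,\dots,t_n$ such that the Galois group of this extension over $\mathbb{Q}(t_1,\dots,t_n)$ is the given group $G$. For $n\ge 2$, $\mathbb{Z}/(n)$ denotes the cyclic additive group of order $n$, and $\mathbb{S}_m$ denotes the symmetric group on $\{1,\dots,m\}$. For a finite group $A$ and a group $G$ acting on the right on a non-empty finite set $S$, let $A^S$ be the group of maps $S\to A$ with pointwise multiplication; $G$ acts on $A^S$ by $(x\cdot\alpha)(s)=\alpha(s\cdot x)$ for $x\in G$, $\alpha\in A^S$, $s\in S$. The wreath product $A\wr G$ is the semidirect product $A^S\rtimes G$ for this action, with product $(\alpha,x)(\beta,y)=(\alpha(x\cdot\beta),xy)$. For $\mathbb{Z}/(n)\wr\mathbb{S}_m$ one takes $S=\{1,\dots,m\}$ with the natural permutation action, and writes elements as $(x,\sigma)$ with $x=(x_1,\dots,x_m)\in(\mathbb{Z}/(n))^m$ and $\sigma\in\mathbb{S}_m$. The Rubik's Cube group $\mathcal{R}$ is the kernel of the group homomorphism \[ \Psi\colon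 \bigl(\mathbb{Z}/(3)\wr\mathbb{S}_8\bigr)\times\bigl(\mathbb{Z}/(2)\wr\mathbb{S}_{12}\bigr)\to \mathbb{Z}/(3)\times\mathbb{Z}/(2)\times\{\pm1\}, \] \[ (x,\rho,y,\sigma)\mapsto\Bigl(\sum_{i=1}^{8}x_i,\ \sum_{i=1}^{12}y_i,\ \operatorname{sign}(\rho)\operatorname{sign}(\sigma)\Bigr), \] where $x=(x_1,\dots,x_8)\in(\mathbb{Z}/(3))^8$, $\rho\in\mathbb{S}_8$, $y=(y_1,\dots,y_{12})\in(\mathbb{Z}/(2))^{12}$, $\sigma\in\mathbb{S}_{12}$. *)

(* Defs.v *)
From HB Require Import structures.
From mathcomp Require Import all_boot all_fingroup all_order all_algebra.
From mathcomp Require Import all_solvable all_field.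
From mathcomp Require Import mpoly.

Set Implicit Arguments.
Unset Strict Implicit.
Unset Printing Implicit Defensive.

Import GroupScope GRing.Theory.

(* The wreath product A^S x| gT.  The parameter [to] does not occur in the
   components of the pair: it determines the group law, hence must be part of
   the type for the group structure to be canonical. *)
Section Wreath.

Variables (A gT : finGroupType) (S : finType).

Record wreath (to : {action gT &-> S}) : predArgType :=
  Wreath { wbase : {ffun S -> A}; wtop : gT }.

Variable to : {action gT &-> S}.
Local Notation wT := (wreath to).

Definition wreath_pair (u : wT) := (wbase u, wtop u).
Definition pair_wreath (p : {ffun S -> A} * gT) : wT := Wreath to p.1 p.2.

Lemma wreath_pairK : cancel wreath_pair pair_wreath.
Proof. by case. Qed.

HB.instance Definition _ := Finite.copy wT (can_type wreath_pairK).

Definition wreath_act (x : gT) (a : {ffun S -> A}) : {ffun S -> A} :=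
  [ffun s => a (to s x)].

Definition wreath_mul (u v : wT) : wT :=
  Wreath to [ffun s => wbase u s * wreath_act (wtop u) (wbase v) s]
         (wtop u * wtop v).

Definition wreath_one : wT := Wreath to [ffun=> 1] 1.

Definition wreath_inv (u : wT) : wT :=
  Wreath to [ffun s => (wreath_act (wtop u)^-1 (wbase u) s)^-1] (wtop u)^-1.

Lemma wreath_mulA : associative wreath_mul.
Proof.
move=> u v w; rewrite /wreath_mul /wreath_act /= mulgA; congr Wreath.
by apply/ffunP=> s; rewrite !ffunE actM mulgA.
Qed.

Lemma wreath_mul1 : left_id wreath_one wreath_mul.
Proof.
case=> a x; rewrite /wreath_mul /wreath_act /= mul1g; congr Wreath.
by apply/ffunP=> s; rewrite !ffunE act1 mul1g.
Qed.

Lemma wreath_mulV : left_inverse wreath_one wreath_inv wreath_mul.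
Proof.
case=> a x; rewrite /wreath_mul /wreath_inv /wreath_act /= mulVg.
by congr Wreath; apply/ffunP=> s; rewrite !ffunE mulVg.
Qed.

HB.instance Definition _ :=
  Finite_isGroup.Build wT wreath_mulA wreath_mul1 wreath_mulV.

End Wreath.

(* MathComp composes permutations left to right, (s * t) i = t (s i), so that
   the natural action 'P of 'S_m on 'I_m is a right action.  Meaningful for n >= 2
   only, as 'Z_0 and 'Z_1 are Z/2. *)
Definition Zwr (n m : nat) : finGroupType :=
  @wreath 'Z_n _ _ (perm_action 'I_m).

Lemma wreath_mul_sum n m (u v : Zwr n m) :
  (\sum_i wbase (u * v)%g i = \sum_i wbase u i + \sum_i wbase v i)%R.
Proof.
rewrite [X in (_ + X)%R](reindex_inj (@perm_inj _ (wtop u))) -big_split /=.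
by apply: eq_bigr => i _; rewrite !ffunE.
Qed.

(* The group law of bool is exclusive or: bool stands for {1, -1}, with
   [true] for -1, and the coercion of a permutation to bool is its sign. *)
Definition rubik_Psi (u : Zwr 3 8 * Zwr 2 12) : 'Z_3 * 'Z_2 * bool :=
  ((\sum_(i < 8) wbase u.1 i)%R, (\sum_(i < 12) wbase u.2 i)%R,
   wtop u.1 (+) wtop u.2).

Lemma rubik_PsiM : {morph rubik_Psi : u v / u * v}.
Proof.
move=> u v; rewrite /rubik_Psi !wreath_mul_sum !odd_permM addbACA; reflexivity.
Qed.

Canonical rubik_Psi_morphism := @Morphism _ _ [set: _] _ (in2W rubik_PsiM).

Definition Rubik : {group Zwr 3 8 * Zwr 2 12} := 'ker rubik_Psi.

(* Main.v *)
Require Import Defs.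
From HB Require Import structures.
From mathcomp Require Import all_boot all_fingroup all_algebra all_field.
From mathcomp Require Import mpoly.
From mathcomp Require Import boolp ring.

Set Implicit Arguments.
Unset Strict Implicit.
Unset Printing Implicit Defensive.

Import GRing.Theory.
Local Open Scope ring_scope.

(** Two facts reduce the problem to finding a suitable field.

    Artin's lemma ([artin_galois]): when a finite group [G] acts on a field [E]
    and no nontrivial element fixes [z], the field generated by the orbit of [z]
    is a Galois extension of its fixed field, with group [G].  So it is enough to
    have an action of the Rubik group [R] where this fixed field is a field of
    rational functions over Q.

    Let [R'] be the group of the pairs for which the edge orientations sum to
    zero and the two permutations have the same sign.  It is generated by [R] and
    the central group [N] of the simultaneous rotations of all the corners: a
    rotation by [c] adds [8 c = - c] to the sum of the corner orientations, so
    that [N] compensates for any such sum.  If [z] is fixed by [N] then the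
    [R]-invariants in the field of the orbit of [z] are the [R']-invariants, and
    [R'] is free of the condition on the sum modulo 3.

    The field is built from the splitting field [L] of the generic trinomial
    [X^8 + a X + b], whose group over Q(a, b) is [S_8] ([trinomial_symmetric]):
    the corner permutation acts on its roots [x_i].  Adding a variable for each of
    the 48 oriented pieces (8 corners, 3 orientations; 12 edges, 2 orientations),
    permuted in the evident way, gives [E] ([generic_variables]).  From the
    variables come, for each corner, elements [T i s] that satisfy
    [T i (s + 1) = - 1 / (T i s + 1)], so that they generate a cyclic cubic
    extension with a single parameter [jj i] (Shanks' simplest cubics), and for
    each edge an element [d j 0] of which a flip changes the sign; put
    [v j = d j 0 ^ 2].  Up to the condition on signs, the invariants of [R'] are
    the rational functions of [a], [b], the weighted power sums
    [J k = sum_i jj i * x_i ^ k], the coefficients of [V = prod_j (X - v j)], and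
    the square root [p = prod_j d j 0] of its constant term, within the field
    generated by [L], the [T i s] and the [d j 0]: this is descent, one element or
    one symmetric group at a time ([gen_descend], [gen_symmetric]).

    The condition on signs adds a square root [dl] of the product of the two
    discriminants, which in general makes a field that is not visibly rational.
    Here the discriminant of the trinomial is, up to the 8th power of [a],
    [8^8 s - 7^7] with [s = b^7 / a^8]: it is linear in [s], so [dl] replaces [s]
    as a parameter, and [b / a] together with [s] gives back [a] and [b].  The
    invariants of [R'] are thus generated by 22 elements ([fixed_pars]); these are
    independent because, with 28 more, they have [E] as an algebraic extension,
    and [E] has transcendence degree 50 ([alg_pars], [ind_steinitz]).

    That the trinomial has group [S_8] is proved by inertia
    ([trinomial_transposition]).  If [y +- h] are two of the roots and [W = h^2]
    then [a] and [b] are polynomials in [y] and [W]; modulo [W] the trinomial has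
    the double root [y] and six other simple roots, and the inertia at the prime
    [W] of Q(y)[W] is generated by the transposition of the two roots.

    Subfields of an arbitrary field, algebraic dependence and the exchange lemma
    are developed for sets of generators ([genfield], [algebraic_over],
    [independent]). *)

(** * Subfields generated by sets *)

Inductive generated (E : fieldType) (S : E -> Prop) : E -> Prop :=
| gen_in x : S x -> generated S x
| gen_1 : generated S 1
| gen_B x y : generated S x -> generated S y -> generated S (x - y)
| gen_M x y : generated S x -> generated S y -> generated S (x * y)
| gen_V x : generated S x -> generated S x^-1.

Definition genfield (E : fieldType) (S : E -> Prop) : {pred E} := fun x => `[< generated S x >].

Lemma genpP (E : fieldType) (S : E -> Prop) x : reflect (generated S x) (x \in genfield S).
Proof. exact: asboolP. Qed.

Lemma genp_divring (E : fieldType) (S : E -> Prop) : divring_closed (genfield S).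
Proof.
split; first exact/genpP/gen_1.
  by move=> x y /genpP Sx /genpP Sy; apply/genpP/gen_B.
by move=> x y /genpP Sx /genpP Sy; apply/genpP/gen_M => //; apply: gen_V.
Qed.

HB.instance Definition _ (E : fieldType) (S : E -> Prop) :=
  GRing.isDivringClosed.Build E (genfield S) (genp_divring S).

Record genfield_type (E : fieldType) (S : E -> Prop) : predArgType :=
  Genfield { genfield_val : E; _ : genfield_val \in genfield S }.

HB.instance Definition _ (E : fieldType) (S : E -> Prop) := [isSub for @genfield_val E S].
HB.instance Definition _ (E : fieldType) (S : E -> Prop) := [Choice of genfield_type S by <:].
HB.instance Definition _ (E : fieldType) (S : E -> Prop) :=
  [SubChoice_isSubIntegralDomain of genfield_type S by <:].
HB.instance Definition _ (E : fieldType) (S : E -> Prop) :=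
  [SubIntegralDomain_isSubField of genfield_type S by <:].

(** * Algebraic dependence *)

Section Generated.
Variable E : fieldType.
Implicit Types (S : E -> Prop) (x y z u e : E) (l t : seq E).

Lemma gen_mono S S' : (forall x, S x -> generated S' x) ->
  forall x, generated S x -> generated S' x.
Proof.
move=> sub x; elim=> {x} [x /sub //||x y _ + _|x y _ + _|x _];
  [exact: gen_1 | exact: gen_B | exact: gen_M | exact: gen_V].
Qed.

Lemma genW S x : S x -> x \in genfield S.
Proof. by move=> Sx; apply/genpP/gen_in. Qed.

Lemma genp_mono S S' : (forall x, S x -> x \in genfield S') -> {subset genfield S <= genfield S'}.
Proof. by move=> sub x /genpP Sx; apply/genpP/(gen_mono _ Sx) => y /sub/genpP. Qed.

Lemma gen_ext S (f g : {rmorphism E -> E}) :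
  (forall x, S x -> f x = g x) -> forall x, x \in genfield S -> f x = g x.
Proof.
move=> fg x /genpP; elim=> {x} [x /fg //||x y _ e1 _ e2|x y _ e1 _ e2|x _ e1].
- by rewrite !rmorph1.
- by rewrite !rmorphB e1 e2.
- by rewrite !rmorphM e1 e2.
- by rewrite !fmorphV e1.
Qed.

Definition adjoin S z : E -> Prop := fun x => S x \/ x = z.
Definition adjoins S l : E -> Prop := foldl adjoin S l.

Lemma adjsE S l x : adjoins S l x <-> S x \/ x \in l.
Proof.
rewrite /adjoins; elim: l S => [|z l IHl] S /=; first by split; [left | case].
rewrite IHl /adjoin inE; split.
  by case=> [[Sx|->]|xl]; [left | right; rewrite eqxx | right; rewrite xl orbT].
by case=> [Sx|/predU1P[->|xl]]; [left; left|left; right|right].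
Qed.

(** Results on polynomials over a field type (division, integrality) are moved
    in this way to the coefficients that lie in a subfield. *)
Lemma polyOver_lift S (p : {poly E}) : p \is a polyOver (genfield S) ->
  exists q : {poly genfield_type S}, map_poly val q = p.
Proof.
move=> /polyOverP Sp; exists (\poly_(i < size p) insubd 0 p`_i).
apply/polyP=> i; rewrite coef_map coef_poly; case: ltnP => [_|le]; last first.
  by rewrite raddf0 nth_default.
by rewrite /= insubdK.
Qed.

Lemma polyOver_val S (q : {poly genfield_type S}) :
  map_poly val q \is a polyOver (genfield S).
Proof. by apply/polyOverP=> i; rewrite coef_map; apply: valP. Qed.

Lemma val_poly_eq0 S (q : {poly genfield_type S}) :
  (map_poly (val : genfield_type S -> E) q == 0) = (q == 0).
Proof. exact: map_poly_eq0. Qed.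

Definition algebraic_over S z := exists p : {poly E},
  [/\ p \is a polyOver (genfield S), p != 0 & root p z].

Lemma algP S z : algebraic_over S z <-> algebraicOver (val : genfield_type S -> E) z.
Proof.
split=> [[p [/polyOver_lift[q <-] nz rt]]|[q nz rt]].
  by exists q; rewrite // -val_poly_eq0.
by exists (map_poly val q); rewrite polyOver_val val_poly_eq0 nz rt.
Qed.

Lemma gen_alg S z : z \in genfield S -> algebraic_over S z.
Proof.
move=> Sz; exists ('X - z%:P); rewrite polyXsubC_eq0 root_XsubC eqxx.
by rewrite rpredB ?polyOverX ?polyOverC.
Qed.

Lemma in_alg_gen S z : S z -> algebraic_over S z.
Proof. by move=> Sz; apply/gen_alg/genW. Qed.

Lemma algB S x y : algebraic_over S x -> algebraic_over S y -> algebraic_over S (x - y).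
Proof. by rewrite !algP; apply: algebraic_sub. Qed.
Lemma algM S x y : algebraic_over S x -> algebraic_over S y -> algebraic_over S (x * y).
Proof. by rewrite !algP; apply: algebraic_mul. Qed.
Lemma algV S x : algebraic_over S x -> algebraic_over S x^-1.
Proof. by rewrite !algP; apply: algebraic_inv. Qed.
Lemma alg1 S : algebraic_over S 1.
Proof. by apply/gen_alg; rewrite rpred1. Qed.

Lemma alg_gen S S' : (forall x, S x -> algebraic_over S' x) ->
  forall x, x \in genfield S -> algebraic_over S' x.
Proof.
move=> sub x /genpP; elim=> {x} [x /sub //||x y _ + _|x y _ + _|x _];
  [exact: alg1 | exact: algB | exact: algM | exact: algV].
Qed.

(** Being algebraic over a field is being integral over it, and integrality is
    transitive. *)
Lemma alg_trans S S' z : (forall x, S x -> algebraic_over S' x) ->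
  algebraic_over S z -> algebraic_over S' z.
Proof.
move=> /alg_gen sub /algP/integral_algebraic[q mq rq].
apply/algP/integral_algebraic/(integral_root_monic (monic_map _ mq) rq).
apply/integral_poly => i; rewrite coef_map.
by apply/integral_algebraic/algP/sub/(valP q`_i).
Qed.

Lemma alg_mono S S' z : (forall x, S x -> S' x) -> algebraic_over S z -> algebraic_over S' z.
Proof. by move=> sub; apply: alg_trans => x /sub/in_alg_gen. Qed.

(** The quotients of values at [z] are closed under the field operations, so the
    elements of a simple extension have explicit forms even when [z] is
    transcendental. *)
Lemma gen_adjP S z e : e \in genfield (adjoin S z) -> exists A B : {poly E},
  [/\ A \is a polyOver (genfield S), B \is a polyOver (genfield S), B.[z] != 0
    & e = A.[z] / B.[z]].
Proof.
move=> /genpP; elim=> {e}.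
- move=> x [Sx|->].
    exists x%:P, 1; rewrite !hornerE polyOverC genW ?rpred1 ?oner_eq0 //.
    by split; rewrite // ?divr1.
  by exists 'X, 1; rewrite !hornerE polyOverX rpred1 oner_eq0; split; rewrite ?divr1.
- by exists 1%:P, 1%:P; split; rewrite ?hornerC ?divr1 ?rpred1 ?oner_eq0.
- move=> x y _ [A [B [SA SB Bz ->]]] _ [A' [B' [SA' SB' Bz' ->]]].
  exists (A * B' - A' * B), (B * B').
  rewrite rpredB ?rpredM // !hornerE mulf_neq0 //; split=> //.
  by field; rewrite Bz Bz'.
- move=> x y _ [A [B [SA SB Bz ->]]] _ [A' [B' [SA' SB' Bz' ->]]].
  exists (A * A'), (B * B').
  by rewrite ?rpredM // !hornerM mulf_neq0 // mulf_div.
- move=> x _ [A [B [SA SB Bz ->]]].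
  have [A0|nzA] := eqVneq A.[z] 0.
    by exists 0, 1%:P; rewrite A0 mul0r invr0 horner0 mul0r hornerC rpred0 rpred1 oner_eq0.
  by exists B, A; split=> //; rewrite invf_div.
Qed.

(** The denominators of the coefficients of an equation of [z] over [S(u)] are
    cleared to get a polynomial in two variables over [S].  Read as a polynomial
    in the other variable it is an equation of [u] over [S(z)]; it vanishes
    identically only if [z] is algebraic over [S]. *)
Lemma alg_exchange S u z : algebraic_over (adjoin S u) z -> ~ algebraic_over S z ->
  algebraic_over (adjoin S z) u.
Proof.
move=> [p [/polyOverP Sp nzp rp]] nalg.
have /fin_all_exists[A /fin_all_exists[B AB]] (i : 'I_(size p)) := gen_adjP (Sp i).
pose D := \prod_i B i; pose C i := A i * \prod_(j | j != i) B j.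
have SC i : C i \is a polyOver (genfield S).
  by have [? _ _ _] := AB i; rewrite rpredM ?rpred_prod // => j _; case: (AB j).
have nzD : D.[u] != 0.
  by rewrite horner_prod; apply/prodf_neq0=> j _; case: (AB j).
have Cu i : (C i).[u] = p`_i * D.[u].
  have [_ _ nzB ->] := AB i.
  by rewrite /D (bigD1 i) //= !hornerM mulrA divfK.
pose F : {poly {poly E}} := \poly_(i < size p) oapp C 0 (insub i).
have FE (i : 'I_(size p)) : F`_i = C i by rewrite coef_poly ltn_ord valK.
have F0 i : (size p <= i)%N -> F`_i = 0 by rewrite coef_poly ltnNge => ->.
pose H := swapXY F.
have SH i : H`_i \is a polyOver (genfield S).
  apply/polyOverP=> j; rewrite coef_swapXY.
  have [lt|/F0 ->] := ltnP j (size p); last by rewrite coef0 rpred0.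
  by rewrite (FE (Ordinal lt)); apply/polyOverP.
have nzH : H != 0.
  rewrite swapXY_eq0; apply: contra_neq nzp => F0'; apply/polyP=> i; rewrite coef0.
  have [lt|/(nth_default 0)//] := ltnP i (size p).
  move/eqP: (Cu (Ordinal lt)); rewrite -FE F0' coef0 horner0 eq_sym.
  by rewrite mulf_eq0 (negPf nzD) orbF => /eqP.
pose h := map_poly (horner_eval z) H.
exists h; split.
- apply/polyOverP=> i; rewrite coef_map /= horner_evalE.
  rewrite horner_coef rpred_sum // => j _; apply: rpredM.
    have /polyOverP/(_ j) := SH i; apply: genp_mono => x Sx.
    by apply/genW; left.
  by apply/rpredX/genW; right.
- have lH : lead_coef H != 0 by rewrite lead_coef_eq0.
  apply/eqP=> /polyP/(_ (size H).-1); rewrite coef0 coef_map /= horner_evalE.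
  move/eqP=> rt; apply: nalg; exists (lead_coef H); split=> //; exact: SH.
- rewrite /root /h /H -horner_polyC horner_poly horner_sum.
  suff -> : \sum_(i < size p) (oapp C 0 (insub (i : nat)) * z%:P ^+ i).[u]
            = D.[u] * p.[z] by rewrite (rootP rp) mulr0.
  rewrite [p.[z]]horner_coef mulr_sumr; apply: eq_bigr => i _.
  by rewrite valK /= hornerM horner_exp hornerC Cu mulrAC mulrC.
Qed.

(** Each entry is transcendental over the previous ones: this is algebraic
    independence, in the form that the exchange lemma handles. *)
Fixpoint independent S l : Prop :=
  if l is x :: l' then ~ algebraic_over S x /\ independent (adjoin S x) l'
  else True.

Lemma ind_anti S S' l : (forall x, S' x -> algebraic_over S x) ->
  independent S l -> independent S' l.
Proof.
elim: l S S' => //= x l IHl S S' sub [nx indl]; split.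
  by move/(alg_trans sub).
apply: IHl indl => y [/sub|->]; last by apply: in_alg_gen; right.
by apply: alg_mono; left.
Qed.

Lemma ind_swap S x y l : independent S [:: x, y & l] -> independent S [:: y, x & l].
Proof.
move=> /= [nx [ny indl]]; split; first by apply: contra_not ny; apply: alg_mono; left.
split; first by move=> Ax; apply: ny; apply: alg_exchange.
apply: ind_anti indl => z Sz; apply: in_alg_gen; move: Sz.
by rewrite /adjoin; tauto.
Qed.

Lemma ind_insert S x l1 l2 : independent S (x :: l1 ++ l2) -> independent S (l1 ++ x :: l2).
Proof.
elim: l1 S => // y l1 IHl S /ind_swap /= [ny indl]; split=> //.
exact: IHl.
Qed.

Lemma ind_sub S l1 l2 : independent S (l1 ++ l2) -> independent S l1.
Proof. by elim: l1 S => //= x l1 IHl S [nx /IHl]. Qed.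

Lemma ind_rcons S l z : independent S (rcons l z) ->
  independent S l /\ ~ algebraic_over (adjoins S l) z.
Proof. by elim: l S => [|x l IHl] S /= [? // /IHl[]]. Qed.

Lemma ind_replace S l1 x z l2 : independent S (l1 ++ x :: l2) ->
    algebraic_over (adjoin (adjoins S l1) x) z -> algebraic_over (adjoin (adjoins S l1) z) x ->
  independent S (l1 ++ z :: l2).
Proof.
elim: l1 S => [|y l1 IHl] S /= [nx indl] Az Ax; last by split=> //; apply: IHl.
split.
  move=> Sz; apply: nx; apply: alg_trans Ax => w [Sw|-> //]; exact: in_alg_gen.
apply: ind_anti indl => w [Sw|-> //]; apply: in_alg_gen; by left.
Qed.

Lemma alg_split S t x : algebraic_over (adjoins S t) x -> ~ algebraic_over S x -> exists t1 y t2,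
  [/\ t = t1 ++ y :: t2, ~ algebraic_over (adjoins S t1) x
    & algebraic_over (adjoin (adjoins S t1) y) x].
Proof.
elim: t S => [|y t IHt] S //= Ax nx.
have [Ay|ny] := pselect (algebraic_over (adjoin S y) x); first by exists [::], y, t.
have [t1 [z [t2 [-> n1 a1]]]] := IHt _ Ax ny.
by exists (y :: t1), z, t2.
Qed.

(** Steinitz: one after the other, each member of [s] is exchanged for a member
    of [t]; as the lengths agree, no member of [t] is left over. *)
Lemma ind_steinitz s t S : size t = size s -> independent S s ->
  (forall z, z \in s -> algebraic_over (adjoins S t) z) -> independent S t.
Proof.
elim: s t S => [|x1 s IHs] t S; first by move/size0nil->.
move=> sz /= [nx1 indx] algx.
have Ax1 : algebraic_over (adjoins S t) x1 by apply: algx; rewrite mem_head.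
have [t1 [y [t2 [Dt n1 a1]]]] := alg_split Ax1 nx1.
have Ay := alg_exchange a1 n1.
have ind12 : independent (adjoin S x1) (t1 ++ t2).
  apply: IHs indx _.
    by move: sz; rewrite Dt !size_cat /= addnS => -[].
  move=> z zx; have: algebraic_over (adjoins S t) z by apply: algx; rewrite inE zx orbT.
  apply: alg_trans => w /adjsE; rewrite Dt mem_cat inE => Sw.
  have [->|nwy] := eqVneq w y.
    apply: alg_mono Ay => v [/adjsE Sv|->]; apply/adjsE; rewrite mem_cat /adjoin.
      by case: Sv => [?|->]; [left; left | right].
    by left; right.
  apply: in_alg_gen; apply/adjsE; rewrite mem_cat /adjoin.
  case: Sw => [?|]; first by left; left.
  by case/or3P=> [->|/eqP wy|->]; rewrite ?orbT; [right | rewrite wy eqxx in nwy | right].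
rewrite Dt; apply: (ind_replace (x := x1)) => //.
exact/ind_insert.
Qed.

End Generated.

Lemma natr_inj (E : fieldType) : [pchar E] =i pred0 -> injective (fun m => m%:R : E).
Proof.
move=> ch0 m n; wlog le : m n / (m <= n)%N => [th e|].
  by case/orP: (leq_total m n) => le; [apply: th | apply/esym/th].
move/eqP; rewrite eq_sym -subr_eq0 -natrB // (proj1 (pcharf0P _) ch0) subn_eq0.
by move=> le'; apply/eqP; rewrite eqn_leq le.
Qed.

(** * Descent along field automorphisms *)

Section Descent.
Variable E : fieldType.
Implicit Types (S : E -> Prop) (z e : E).

Lemma polyOver_divp S (p q : {poly E}) :
  p \is a polyOver (genfield S) -> q \is a polyOver (genfield S) ->
  p %/ q \is a polyOver (genfield S) /\ p %% q \is a polyOver (genfield S).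
Proof.
move=> /polyOver_lift[a <-] /polyOver_lift[b <-].
by rewrite -map_divp -map_modp !polyOver_val.
Qed.

(** Descent along a simple extension: if [e = A(z) / B(z)] is fixed by enough
    automorphisms then [A - e B] vanishes at all the conjugates of [z]; after
    reduction modulo their monic polynomial it vanishes identically, so [e] is
    a quotient of coefficients. *)
Lemma gen_descend S z (zs : seq E) e :
    uniq zs -> z \in zs -> \prod_(y <- zs) ('X - y%:P) \is a polyOver (genfield S) ->
    e \in genfield (adjoin S z) ->
    (forall y, y \in zs -> exists f : {rmorphism E -> E},
      [/\ forall s, S s -> f s = s, f z = y & f e = e]) ->
  e \in genfield S.
Proof.
set Q := \prod_(y <- zs) _ => Uzs zzs SQ Se conj.
have mQ : Q \is monic by apply: monic_prod_XsubC.
have [A [B [SA SB nzB De]]] := gen_adjP Se.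
have fixp (f : {rmorphism E -> E}) (p : {poly E}) : (forall s, S s -> f s = s) ->
  p \is a polyOver (genfield S) -> map_poly f p = p.
  move=> fS /polyOverP Sp; apply/polyP=> i; rewrite coef_map /=.
  exact: (@gen_ext _ S f idfun).
have rootQ y : y \in zs -> Q.[y] = 0.
  by move=> yzs; apply/rootP; rewrite root_prod_XsubC.
have modQ (p : {poly E}) y : y \in zs -> (p %% Q).[y] = p.[y].
  by move=> yzs; rewrite {2}(divp_eq p Q) !hornerE rootQ // mulr0 add0r.
have AB y : y \in zs -> A.[y] = e * B.[y].
  move=> yzs; have [f [fS fz fe]] := conj _ yzs.
  have /(congr1 f) : A.[z] = e * B.[z] by rewrite De divfK.
  by rewrite rmorphM /= -!horner_map /= fe fz !fixp.
have AB0 : A %% Q - e *: (B %% Q) = 0.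
  apply: (@roots_geq_poly_eq0 _ _ zs) => //.
    apply/allP=> y yzs; rewrite /root !hornerE !modQ // AB // subrr //.
  have szQ : size Q = (size zs).+1 by rewrite size_prod_XsubC.
  have ltm p : (size (p %% Q)%R <= size zs)%N.
    by rewrite -ltnS -szQ ltn_modp monic_neq0.
  rewrite (leq_trans (size_polyD _ _)) // geq_max ltm size_polyN.
  by rewrite (leq_trans (size_scale_leq _ _)).
have nzBQ : B %% Q != 0.
  by apply: contraNneq nzB => BQ0; rewrite -modQ // BQ0 horner0.
pose i := (size (B %% Q)).-1.
have nzi : (B %% Q)`_i != 0 by rewrite -lead_coefE lead_coef_eq0.
have /polyP/(_ i)/eqP := AB0; rewrite coefB coefZ coef0 subr_eq0 => /eqP Di.
have -> : e = (A %% Q)`_i / (B %% Q)`_i by rewrite Di mulfK.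
have [_ /polyOverP SA'] := polyOver_divp SA SQ.
by have [_ /polyOverP SB'] := polyOver_divp SB SQ; rewrite rpred_div.
Qed.

(** The fundamental theorem of symmetric functions, for rational functions, by
    descent along [v_(n-1), ..., v_0]: over the field of [v_0, ..., v_(m-1)] the
    transpositions of [m] with the larger indices show that all the remaining
    [v_j] are conjugates of [v_m]. *)
Lemma gen_symmetric S n (v : 'I_n -> E) e :
    injective v -> \prod_i ('X - (v i)%:P) \is a polyOver (genfield S) ->
    e \in genfield (fun x => S x \/ exists i, x = v i) ->
    (forall i j, exists f : {rmorphism E -> E},
      [/\ forall s, S s -> f s = s, forall k, f (v k) = v (tperm i j k)
        & f e = e]) ->
  e \in genfield S.
Proof.
move=> vI SP Se conj; pose T r x := S x \/ exists2 i : 'I_n, (i < r)%N & x = v i.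
suff TeP r : e \in genfield (T (n - r)%N).
  have := TeP n; rewrite subnn; apply: genp_mono => x [|[i //]]; exact: genW.
elim: r => [|r IHr].
  apply: genp_mono Se => x Sx; apply: genW; rewrite subn0.
  by case: Sx => [|[i ->]]; [left | right; exists i].
have [le|lt] := leqP n r.
  by move: le IHr; rewrite -subn_eq0 subnS => /eqP->.
move: IHr; rewrite -(subnSK lt); set m := (n - r.+1)%N => IHr.
have ltm : (m < n)%N by rewrite /m ltn_subrL (leq_ltn_trans _ lt).
pose i0 := Ordinal ltm.
pose zs := [seq v i | i : 'I_n <- enum 'I_n & (m <= i)%N].
have Dprod (P : pred 'I_n) : \prod_(y <- [seq v i | i <- enum 'I_n & P i]) ('X - y%:P)
    = \prod_(i | P i) ('X - (v i)%:P).
  by rewrite big_map big_filter big_enum_cond.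
apply: (gen_descend (z := v i0) (zs := zs)).
- by rewrite map_inj_uniq // filter_uniq ?enum_uniq.
- by apply/map_f; rewrite mem_filter leqnn mem_enum.
- rewrite Dprod.
  pose P1 := \prod_(i < n | ~~ (m <= i)%N) ('X - (v i)%:P).
  have mP1 : P1 != 0 by rewrite monic_neq0 // monic_prod // => i _; apply: monicXsubC.
  have -> : \prod_(i < n | (m <= i)%N) ('X - (v i)%:P)
           = \prod_i ('X - (v i)%:P) %/ P1.
    by rewrite [in RHS](bigID (fun i : 'I_n => m <= i)%N) /= mulpK.
  have [] // := @polyOver_divp (T m) (\prod_i ('X - (v i)%:P)) P1.
    apply/polyOverP=> i; have /polyOverP/(_ i) := SP.
    by apply: genp_mono => x Sx; apply: genW; left.
  rewrite rpred_prod // => i; rewrite -ltnNge => lti.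
  by rewrite rpredB ?polyOverX ?polyOverC // genW //; right; exists i.
- apply: genp_mono IHr => x [Sx|[i]]; first by apply: genW; left; left.
  rewrite ltnS leq_eqVlt => /orP[/eqP Di|lti] ->; apply: genW.
    by right; congr v; apply: val_inj.
  by left; right; exists i.
- move=> y /mapP[j]; rewrite mem_filter => /andP[lemj _] ->.
  have [f [fS fv fe]] := conj i0 j; exists f; split=> //; last by rewrite fv tpermL.
  move=> s [/fS //|[i lti ->]]; rewrite fv tpermD //.
    by rewrite -val_eqE /= gtn_eqF.
  by rewrite -val_eqE /= gtn_eqF // (leq_trans lti).
Qed.
End Descent.

(** * Rational functions in several variables *)

Local Notation "x %:F" := (@FracField.tofrac _ x).

Section FractionLift.
Variables (R : idomainType) (K : fieldType).

Lemma fracE (x : {fraction R}) : exists n d : R, d != 0 /\ x = n%:F / d%:F.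
Proof.
elim/quotW: x => r; exists \n_r, \d_r; split; first exact: denom_ratioP.
apply: (canRL (mulfK _)); first by rewrite tofrac_eq0 denom_ratioP.
unlock FracField.tofrac; rewrite -[LHS]FracField.pi_mul.
apply/eqmodP; rewrite /= FracField.equivfE /FracField.mulf.
by rewrite !numden_Ratio ?mulf_neq0 ?oner_neq0 ?denom_ratioP //= !(mulr1, mul1r) mulrC.
Qed.

(** Injectivity of [f] keeps the images of the denominators away from zero. *)
Lemma frac_lift (f : {rmorphism R -> K}) : injective f ->
  exists g : {rmorphism {fraction R} -> K}, forall r, g r%:F = f r.
Proof.
move=> fI.
have /boolp.choice[g /all_and2[nzg Dg]] : forall x : {fraction R},
    exists nd : R * R, nd.2 != 0 /\ x = nd.1%:F / nd.2%:F.
  by move=> x; have [n [d]] := fracE x; exists (n, d).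
have nzf d : d != 0 -> f d != 0 by rewrite -(inj_eq fI) rmorph0.
pose h x := f (g x).1 / f (g x).2.
have hE n d : d != 0 -> h (n%:F / d%:F) = f n / f d.
  move=> nzd; rewrite /h; set x : {fraction R} := n%:F / d%:F; have := Dg x.
  move/eqP; rewrite eqr_div ?tofrac_eq0 // -!tofracM tofrac_eq => /eqP e.
  by apply/eqP; rewrite eqr_div ?nzf // -!rmorphM e.
have hR r : h r%:F = f r.
  by have := hE r 1 (oner_neq0 _); rewrite tofrac1 rmorph1 !divr1.
have hB : zmod_morphism h.
  move=> x y; have [n [d [nzd ->]]] := fracE x; have [n' [d' [nzd' ->]]] := fracE y.
  rewrite -mulNr -tofracN addf_div ?tofrac_eq0 // -!tofracM -tofracD.
  rewrite !hE ?mulf_neq0 // -mulNr -(rmorphN f) addf_div ?nzf //.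
  by rewrite rmorphD !rmorphM.
have hM : monoid_morphism h.
  split; first by rewrite -tofrac1 hR rmorph1.
  move=> x y; have [n [d [nzd ->]]] := fracE x; have [n' [d' [nzd' ->]]] := fracE y.
  rewrite mulf_div -!tofracM !hE ?mulf_neq0 // mulf_div !rmorphM //.
pose hz := GRing.isZmodMorphism.Build _ _ h hB.
pose hm := GRing.isMonoidMorphism.Build _ _ h hM.
pose h' : {rmorphism {fraction R} -> K} := HB.pack h hz hm.
by exists h'.
Qed.
End FractionLift.

Section MpolyHom.
Local Notation widen := (widen_ord (leqnSn _)).

Lemma mpoly_hom (R A : comNzRingType) n (f : {rmorphism {mpoly R[n]} -> A}) p :
  f p = mmap (f \o @mpolyC n R) (fun i => f 'X_i) p.
Proof.
rewrite {1}[p]mpolyE rmorph_sum; apply: eq_bigr => m _.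
rewrite -mul_mpolyC rmorphM; congr (_ * _).
by rewrite mpolyXE_id rmorph_prod; apply: eq_bigr => i _; rewrite rmorphXn.
Qed.

Lemma mpoly_ext (R A : comNzRingType) n (f g : {rmorphism {mpoly R[n]} -> A}) :
  (forall c, f c%:MP = g c%:MP) -> (forall i, f 'X_i = g 'X_i) -> f =1 g.
Proof.
move=> fgC fgX p; rewrite [LHS]mpoly_hom [RHS]mpoly_hom.
apply: eq_bigr => m _; congr (_ * _); first exact: fgC.
by apply: eq_bigr => i _; rewrite fgX.
Qed.

Lemma muni_widen n (R : comNzRingType) (j : 'I_n) :
  muni ('X_(widen j) : {mpoly R[n.+1]}) = ('X_j)%:P.
Proof.
rewrite muniE msuppX big_seq1 mcoeffX eqxx scale1r mnm1E.
have -> : (widen j == ord_max) = false by rewrite -val_eqE /= ltn_eqF.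
rewrite expr0 alg_polyC; congr ('X_[_])%:P; apply/mnmP=> k.
by rewrite mnmE !mnm1E.
Qed.

Lemma muni_max n (R : comNzRingType) :
  muni ('X_ord_max : {mpoly R[n.+1]}) = 'X.
Proof.
rewrite muniE msuppX big_seq1 mcoeffX eqxx scale1r mnm1E eqxx expr1.
rewrite (_ : [multinom _ | _ < _] = 0%MM) ?mpolyX0 ?scale1r //.
by apply/mnmP=> k; rewrite mnmE mnm1E mnm0E -val_eqE /= gtn_eqF.
Qed.

Lemma mpoly_extS (R A : comNzRingType) n (f g : {rmorphism {mpoly R[n.+1]} -> A}) :
  (forall c, f c%:MP = g c%:MP) -> (forall i : 'I_n, f 'X_(widen i) = g 'X_(widen i)) ->
  f 'X_ord_max = g 'X_ord_max -> f =1 g.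
Proof.
move=> fgC fgX fgm; apply: mpoly_ext => // i.
have [lt|le] := ltnP i n.
  have -> : i = widen (Ordinal lt) by apply: val_inj.
  exact: fgX.
suff -> : i = ord_max by [].
by apply: val_inj; apply/eqP; rewrite eqn_leq le -ltnS ltn_ord.
Qed.

Lemma muni_inj n (R : comNzRingType) : injective (@muni n R).
Proof.
pose w : {rmorphism {mpoly R[n]} -> {mpoly R[n.+1]}} := @mwiden n R.
have com : commr_rmorph w 'X_ord_max by move=> x; apply: mulrC.
pose g : {rmorphism {poly {mpoly R[n]}} -> {mpoly R[n.+1]}} := horner_morph com.
apply: (@can_inj _ _ _ g) => p.
apply: (@mpoly_extS R _ n (g \o @muni n R) idfun) => [c|i|] /=.
- by rewrite muniC horner_morphC /=; apply: mwidenC.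
- by rewrite muni_widen horner_morphC /= /mwiden mmapX mmap1U.
- by rewrite muni_max horner_morphX.
Qed.

Lemma mmap_gen (k E : fieldType) (h : {rmorphism k -> E}) (S : E -> Prop) n
    (t : 'I_n -> E) (p : {mpoly k[n]}) :
  (forall c, h c \in genfield S) -> (forall i, t i \in genfield S) -> mmap h t p \in genfield S.
Proof.
move=> Sh St; rewrite rpred_sum // => m _; rewrite rpredM //.
by rewrite rpred_prod // => i _; rewrite rpredX.
Qed.

(** A relation is a polynomial in the last variable whose coefficients are
    polynomials in the other ones.  The last element is transcendental over these,
    so all the coefficients vanish at the first elements, and induction applies. *)
Lemma ind_mmap_inj (k E : fieldType) (h : {rmorphism k -> E}) (S : E -> Prop) :
    (forall c, h c \in genfield S) -> forall n (t : 'I_n -> E),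
  independent S [seq t i | i <- enum 'I_n] -> forall p : {mpoly k[n]}, mmap h t p = 0 -> p = 0.
Proof.
move=> Sh; elim=> [|n IHn] t indt p p0.
  have Dp : p = (p@_0)%:MP.
    apply/mpolyP=> m; rewrite mcoeffC (_ : m = 0%MM) ?eqxx ?mulr1 //.
    by apply/mnmP=> -[].
  move: p0; rewrite Dp mmapC => /eqP; rewrite fmorph_eq0 => /eqP->.
  by rewrite mpolyC0.
pose t' i := t (widen i).
move: indt; rewrite enum_ordSr map_rcons -map_comp => /ind_rcons[indt nalg].
pose w : {rmorphism {mpoly k[n]} -> E} := mmap h t'.
have com : commr_rmorph w (t ord_max) by move=> x; apply: mulrC.
have Dp : mmap h t p = (map_poly w (muni p)).[t ord_max].
  apply: (@mpoly_extS k _ n (mmap h t) (horner_morph com \o @muni n k)) => [c|i|] /=.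
  - by rewrite muniC horner_morphC /= !mmapC.
  - by rewrite muni_widen horner_morphC /= !mmapX !mmap1U.
  - by rewrite muni_max horner_morphX mmapX mmap1U.
apply/eqP; apply: contra_notT nalg => nzp.
exists (map_poly w (muni p)); split; last by rewrite /root -Dp p0.
  apply/polyOverP=> i; rewrite coef_map; apply: mmap_gen => [c|j].
    by apply: genp_mono (Sh c) => x Sx; apply/genW/adjsE; left.
  by apply/genW/adjsE; right; apply: (map_f (t \o widen)); rewrite mem_enum.
have nzu : lead_coef (muni p) != 0.
  rewrite lead_coef_eq0; apply: contra_neq nzp => e; apply: muni_inj.
  by rewrite e raddf0.
apply: contra_neq nzu => /polyP/(_ (size (muni p)).-1); rewrite coef_map coef0.
exact: IHn.
Qed.
End MpolyHom.

(** * Artin's lemma *)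

Definition splitting_pack (F : fieldType) (L : fieldExtType F)
    (ax : splitting_field_axiom L) : splittingFieldType F :=
  HB.pack (FieldExt.sort L) (FieldExt_isSplittingField.Build F L ax).

Section Artin.
Variables (F E : fieldType) (iota : {rmorphism F -> E}).
Variables (gT : finGroupType) (G : {group gT}) (act : gT -> {rmorphism E -> E}).
Variable z : E.
Let orb e := exists2 g, g \in G & e = act g z.
Hypothesis actM : forall g h, g \in G -> h \in G ->
  forall e, act (g * h)%g e = act h (act g e).
Hypothesis act_base : forall g c, g \in G -> act g (iota c) = iota c.
Hypothesis act_fixed : forall e, e \in genfield orb ->
  (forall g, g \in G -> act g e = e) -> exists c, e = iota c.
Hypothesis act_free : forall g, g \in G -> act g z = z -> g = 1%g.

Let act1 e : act 1%g e = e.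
Proof. by apply: (fmorph_inj (act 1%g)); rewrite -actM ?group1 // mulg1. Qed.

Let act_inj g h : g \in G -> h \in G -> act g z = act h z -> g = h.
Proof.
move=> Gg Gh e; apply/eqP; rewrite eq_mulgV1; apply/eqP/act_free.
  by rewrite groupM ?groupV.
by rewrite actM ?groupV // e -actM ?groupV // mulgV act1.
Qed.

Let orb_act g : g \in G -> act g z \in genfield orb.
Proof. by move=> Gg; apply: genW; exists g. Qed.

Let poly_descends (p : {poly E}) : p \is a polyOver (genfield orb) ->
  (forall g, g \in G -> map_poly (act g) p = p) -> exists q, p = map_poly iota q.
Proof.
move=> /polyOverP op fp.
have /boolp.choice[c Dc] : forall i, exists c, p`_i = iota c.
  move=> i; apply: act_fixed => // g Gg.
  by rewrite -[in LHS]coef_map fp.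
exists (\poly_(i < size p) c i); apply/polyP=> i; rewrite coef_map coef_poly.
by case: ltnP => [_|le]; [exact: Dc | rewrite raddf0 nth_default].
Qed.

(** The interpolation polynomial of the values [act h e] at the conjugates
    [act h z], without the denominators: when [e] lies in the field of the orbit,
    [G] permutes the summands, so that the coefficients are in [F], and [e] is the
    quotient of the values of [lag e] and [lag 1] at [z]. *)
Let lag e := \sum_(h in G) act h e *: \prod_(k in G | k != h) ('X - (act k z)%:P).

Let lag_descends e : e \in genfield orb -> exists q, lag e = map_poly iota q.
Proof.
have act_orb g x : g \in G -> x \in genfield orb -> act g x \in genfield orb.
  move=> Gg /genpP; elim=> {x}.
  - by move=> _ [h Gh ->]; rewrite -actM // orb_act ?groupM.
  - by rewrite rmorph1 rpred1.
  - by move=> x y _ ox _ oy; rewrite rmorphB rpredB.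
  - by move=> x y _ ox _ oy; rewrite rmorphM rpredM.
  - by move=> x _ ox; rewrite fmorphV rpredV.
move=> oe; apply: poly_descends => [|g Gg].
  rewrite rpred_sum // => h Gh; rewrite polyOverZ ?act_orb //.
  rewrite rpred_prod // => k /andP[Gk _].
  by rewrite rpredB ?polyOverX ?polyOverC ?orb_act.
rewrite /lag [RHS](reindex_inj (mulIg g)) /= rmorph_sum /=.
apply: eq_big => [h|h Gh]; first by rewrite groupMr.
rewrite linearZ /= -actM // [in RHS](reindex_inj (mulIg g)) rmorph_prod /=.
congr (_ *: _); apply: eq_big => [k|k /andP[Gk _]].
  by rewrite groupMr // (inj_eq (mulIg g)).
by rewrite rmorphB /= map_polyX map_polyC /= -actM.
Qed.

Let lag_z e : (lag e).[z] = e * (lag 1).[z] /\ (lag 1).[z] != 0.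
Proof.
have eval x : (lag x).[z] = x * (\prod_(k in G | k != 1%g) ('X - (act k z)%:P)).[z].
  rewrite /lag horner_sum (bigD1 1%g) //= act1 hornerZ [X in _ + X]big1 ?addr0 // => h.
  case/andP=> Gh nh1; rewrite hornerZ (bigD1 1%g) /=; last by rewrite group1 eq_sym.
  by rewrite hornerM act1 hornerXsubC subrr mul0r mulr0.
split; first by rewrite !eval mul1r.
rewrite eval mul1r horner_prod; apply/prodf_neq0 => k /andP[Gk nk].
by rewrite !hornerE subr_eq0; apply: contraNneq nk => /esym/(act_free Gk)->.
Qed.

Let P := \prod_(g in G) ('X - (act g z)%:P).

(** The coefficients are in [F], as [G] permutes the factors. *)
Lemma artin_minpoly : exists p, P = map_poly iota p.
Proof.
apply: poly_descends => [|g Gg].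
  rewrite rpred_prod // => k Gk.
  by rewrite rpredB ?polyOverX ?polyOverC ?orb_act.
rewrite /P rmorph_prod [RHS](reindex_inj (mulIg g)) /=.
apply: eq_big => [h|h Gh]; first by rewrite groupMr.
by rewrite rmorphB /= map_polyX map_polyC /= -actM.
Qed.

Let conj_root (q : {poly F}) g : g \in G ->
  root (map_poly iota q) z -> root (map_poly iota q) (act g z).
Proof.
move=> Gg /(rmorph_root (act g)); rewrite -map_poly_comp.
by rewrite (eq_map_poly (g := iota)) // => c /=; apply: act_base.
Qed.

(** The extension is the field of [z] over [F].  It contains all the conjugates
    of [z] by interpolation, hence it is normal. *)
Let orbit_field : exists (L : splittingFieldType F) (inj : {rmorphism L -> E})
    zt (r : gT -> L),
  [/\ galois 1%AS {:L}, inj zt = z, forall c, inj c%:A = iota c,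
      forall y : L, exists q, y = (map_poly (in_alg L) q).[zt]
    & forall g, g \in G -> inj (r g) = act g z].
Proof.
have [p Dp] := artin_minpoly.
have pz0 : root (map_poly iota p) z.
  rewrite -Dp /P (bigD1 1%g) //= act1 rootM root_XsubC eqxx //.
have nzp : p != 0.
  rewrite -(map_poly_eq0 iota) -Dp; apply/prodf_neq0=> g _.
  by rewrite polyXsubC_eq0.
have irr_p : irreducible_poly p.
  apply/(subfx_irreducibleP pz0 nzp) => q qz nzq.
  rewrite -(size_map_poly iota) -Dp /P -(size_map_poly iota q).
  have -> : \prod_(g in G) ('X - (act g z)%:P)
          = \prod_(x <- [seq act g z | g <- enum G]) ('X - x%:P).
    by rewrite big_map big_enum.
  rewrite size_prod_XsubC; apply: max_poly_roots; rewrite ?map_poly_eq0 //.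
    apply/allP=> x /mapP[g]; rewrite mem_enum => Gg ->; exact: conj_root.
  rewrite map_inj_in_uniq ?enum_uniq // => g h; rewrite !mem_enum; exact: act_inj.
pose L0 := SubFieldExtType pz0 irr_p.
pose inj : {rmorphism L0 -> E} := @subfx_inj F E iota z p.
pose zt : L0 := subfx_root iota z p.
have inj_zt : inj zt = z by apply: subfx_inj_root.
have inj_base c : inj c%:A = iota c by apply: subfx_inj_base.
have injI : injective inj by apply: fmorph_inj.
have lift e : e \in genfield orb -> exists r, inj r = e.
  move=> oe; have [q1 D1] := lag_descends oe; have [q2 D2] := lag_descends (rpred1 _).
  exists (subfx_eval iota z p q1 / subfx_eval iota z p q2).
  rewrite fmorph_div /= !subfx_inj_eval // -D1 -D2.
  have [-> nz] := lag_z e; exact: mulfK.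
have /boolp.choice[r Dr] : forall g, exists r, g \in G -> inj r = act g z.
  move=> g; have [/orb_act/lift[r Dr]|] := boolP (g \in G); last by exists 0.
  by exists r.
pose pA := map_poly (in_alg L0) p.
have pAE : map_poly inj pA = P.
  by rewrite -map_poly_comp Dp; apply: eq_map_poly => c /=; apply: inj_base.
pose rs := [seq r g | g <- enum G].
have DpA : pA = \prod_(x <- rs) ('X - x%:P).
  apply: (map_poly_inj inj); rewrite pAE rmorph_prod /= big_map big_enum /=.
  by apply: eq_bigr => g Gg; rewrite rmorphB /= map_polyX map_polyC /= Dr.
have zt_rs : zt \in rs.
  apply/mapP; exists 1%g; rewrite ?mem_enum ?group1 //.
  by apply: injI; rewrite Dr ?group1 // act1.
have baseU (c : F) (U : {subfield L0}) : (c%:A : L0) \in U by rewrite memvZ ?mem1v.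
have genL : <<1 & rs>>%VS = {:L0}%VS.
  apply/eqP; rewrite eqEsubv subvf; apply/subvP=> x _.
  have [q ->] := subfxEroot pz0 nzp x.
  apply: rpred_horner; last exact: seqv_sub_adjoin.
  by apply/polyOverP=> i; rewrite coef_map; apply: baseU.
have pA1 : pA \is a polyOver 1%VS.
  by apply/polyOverP=> i; rewrite coef_map; apply: (baseU _ 1%AS).
have spl : splittingFieldFor 1 pA {:L0} by exists rs; rewrite // DpA eqpxx.
have splax : splitting_field_axiom L0 by exists pA.
pose L : splittingFieldType F :=
  splitting_pack splax.
have galL : galois 1%AS {:L}.
  apply/splitting_galoisField; exists pA; split=> //.
  rewrite DpA separable_prod_XsubC map_inj_in_uniq ?enum_uniq // => g h.
  rewrite !mem_enum => Gg Gh e; apply: act_inj => //; rewrite -!Dr //.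
  by rewrite e.
exists L, inj, zt, r; split=> // y.
by have [q ->] := subfxEroot pz0 nzp y; exists q.
Qed.

(** An automorphism over [F] sends [z] to a conjugate [act g z], with [g] unique
    by freeness; [s |-> g] is the isomorphism. *)
Theorem artin_galois : exists L : splittingFieldType F,
  galois 1%AS {:L} /\ 'Gal({:L} / 1)%G \isog G.
Proof.
have [L [inj [zt [r [galL inj_zt inj_base evalL Dr]]]]] := orbit_field.
exists L; split=> //; have injI : injective inj by apply: fmorph_inj.
have rootA (q : {poly F}) (y : L) :
    root (map_poly (in_alg L) q) y = root (map_poly iota q) (inj y).
  rewrite -(fmorph_root inj) -map_poly_comp; congr (root _ _).
  by apply: eq_map_poly => c; apply: inj_base.
pose f (s : gal_of {:L}) := odflt 1%g [pick g in G | s zt == r g].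
have conj_gal (s : gal_of {:L}) : s \in 'Gal({:L} / 1)%G ->
    exists2 g, g \in G & s zt = r g.
  move=> Gs; have [p Dp] := artin_minpoly.
  have pz : root (map_poly (in_alg L) p) (s zt).
    rewrite -dvdp_XsubCl; apply: dvdp_trans (minPoly_dvdp _ _ : minPoly 1 zt %| _).
    - by rewrite dvdp_XsubCl (root_minPoly_gal (sub1v _) Gs) ?memvf.
    - by apply/polyOver1P; exists p.
    - rewrite rootA inj_zt -Dp /P (bigD1 1%g) //= act1 rootM root_XsubC eqxx //.
  move: pz; rewrite rootA -Dp /root horner_prod prodf_seq_eq0.
  case/hasP=> g _ /andP[Gg]; rewrite hornerXsubC subr_eq0 => /eqP e.
  by exists g => //; apply: injI; rewrite e Dr.
have fP s : s \in 'Gal({:L} / 1)%G -> f s \in G /\ s zt = r (f s).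
  move=> /conj_gal[g Gg e]; rewrite /f.
  by case: pickP => [h /andP[Gh /eqP]|/(_ g)] //=; rewrite Gg e eqxx.
have inj_gal s y : s \in 'Gal({:L} / 1)%G -> inj (s y) = act (f s) (inj y).
  move=> Gs; have [Gf e] := fP s Gs; have [q ->] := evalL y.
  rewrite -[in LHS]horner_map -map_poly_comp.
  rewrite (eq_map_poly (g := in_alg L)) => [|c /=]; last by rewrite linearZ rmorph1.
  rewrite [X in _.[X]]e.
  rewrite -!horner_map /= -!map_poly_comp Dr // inj_zt.
  congr (_.[_]); apply: eq_map_poly => c /=.
  by rewrite inj_base act_base.
have fM : {in 'Gal({:L} / 1)%G &, {morph f : s t / (s * t)%g}}.
  move=> s t Gs Gt; have [Gfs es] := fP s Gs; have [Gft et] := fP t Gt.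
  have [Gfst est] := fP _ (groupM Gs Gt).
  have e1 : inj ((s * t)%g zt) = act (f s * f t)%g z.
    have -> : (s * t)%g zt = t (s zt) by apply: galM; apply: memvf.
    by rewrite (inj_gal t) // es Dr // actM.
  by apply: act_inj (groupM Gfs Gft) _ => //; rewrite -e1 est Dr.
apply/isogP; exists (Morphism fM).
  apply/injmP=> s t Gs Gt /= e; apply/eqP/gal_eqP=> y _.
  by apply: injI; rewrite !inj_gal // e.
apply/eqP; rewrite eqEsubset; apply/andP; split.
  by apply/subsetP=> _ /morphimP[s _ Gs ->] /=; case: (fP s Gs).
apply/subsetP=> g Gg.
have rt : root (minPoly 1 zt) (r g).
  have /polyOver1P[q Dq] := minPolyOver 1%AS zt.
  have := root_minPoly 1%AS zt; rewrite Dq !rootA Dr // inj_zt.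
  exact: conj_root.
have nf : normalField 1 {:L} by case/and3P: galL.
have [s Gs es] := normalField_root_minPoly (sub1v _) nf (memvf zt) rt.
apply/morphimP; exists s => //=; have [Gf e] := fP s Gs.
by apply: act_inj; rewrite // -!Dr // -e es.
Qed.
End Artin.

(** * Splitting fields *)

Section SplittingField.

Lemma irreducible_factor (F : fieldType) (p : {poly F}) : (1 < size p)%N ->
  exists2 r, r %| p & irreducible_poly r.
Proof.
move: {2}(size p) (leqnn (size p)) => n; elim: n p => [|n IHn] p le_p p_gt1.
  by move: p_gt1; rewrite ltnNge (leq_trans le_p).
have [irr|red] := pselect (irreducible_poly p); first by exists p.
have [q [nq qp neq]] : exists q : {poly F}, [/\ size q != 1, q %| p & ~~ (q %= p)].
  apply: contrapT => all_irr; apply: red; split=> // q nq qp.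
  by apply/negPn/negP => neq; apply: all_irr; exists q.
have nzp : p != 0 by rewrite -size_poly_gt0 ltnW.
have nzq : q != 0 by apply: contraNneq nzp => q0; rewrite q0 dvd0p in qp.
have q_gt1 : (1 < size q)%N by rewrite ltn_neqAle eq_sym nq size_poly_gt0.
have lt_qp : (size q < size p)%N.
  by rewrite ltn_neqAle dvdp_leq // andbT; apply: contra neq; rewrite dvdp_size_eqp.
have [|r rq irr] := IHn q _ q_gt1; first by rewrite -ltnS (leq_trans lt_qp).
by exists r => //; apply: dvdp_trans qp.
Qed.

Let base_or_root (F : fieldType) (L : fieldExtType F) (zs : seq L) (x : L) :=
  (exists c : F, x = c%:A) \/ x \in zs.

(** Roots of irreducible factors are adjoined one at a time.  Generation by the
    roots is stated with [genfield], where morphisms are compared. *)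
Let splits_ext (F : fieldType) (p : {poly F}) : p != 0 ->
  exists (L : fieldExtType F) (zs : seq L),
    map_poly (in_alg L) p %= \prod_(z <- zs) ('X - z%:P) /\
    forall y, y \in genfield (base_or_root zs).
Proof.
move: {2}(size p) (leqnn (size p)) => n; elim: n F p => [|n IHn] F p le_p nzp.
  by move: nzp; rewrite -size_poly_eq0 -leqn0 le_p.
have [sz1|p_gt1] := leqP (size p) 1.
  exists F^o, [::]; split.
    by rewrite big_nil -size_poly_eq1 size_map_poly eqn_leq sz1 size_poly_gt0.
  by move=> y; apply: genW; left; exists y; rewrite /GRing.scale /= mulr1.
have [r rp irr_r] := irreducible_factor p_gt1.
have [K _ [x rx genK]] := irredp_FAdjoin irr_r.
have px : root (map_poly (in_alg K) p) x.
  have /dvdpP[q ->] := rp; rewrite rmorphM rootM rx orbT //.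
have [q Dq] := factor_theorem _ _ px.
have szp : size p = (size q).+1.
  have nzq : q != 0.
    by apply: contraNneq nzp => q0; rewrite -(map_poly_eq0 (in_alg K)) Dq q0 mul0r.
  rewrite -(size_map_poly (in_alg K)) Dq size_mul ?polyXsubC_eq0 //.
  by rewrite size_XsubC addn2.
have [||L [zs [Dzs genL]]] := IHn K q.
- by rewrite -ltnS -szp.
- by rewrite -size_poly_gt0 -ltnS -szp.
exists (baseFieldType L), (x%:A :: zs : seq L); split.
  have -> : map_poly (in_alg (baseFieldType L)) p
          = map_poly (in_alg L) (map_poly (in_alg K) p).
    rewrite -[RHS]map_poly_comp; apply: eq_map_poly => a.
    exact: baseField_scaleE.
  rewrite Dq big_cons mulrC rmorphM /= rmorphB /= map_polyX map_polyC /=.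
  exact: eqp_mull.
move=> y; apply: (genp_mono _ (genL y)) => z [[c ->]|zzs]; last first.
  by apply: genW; right; rewrite inE zzs orbT.
have /Fadjoin_polyP[s /polyOver1P[t ->] ->] : c \in <<1; x>>%VS by rewrite genK memvf.
rewrite -[_%:A]/(in_alg L _) -horner_map /=.
apply: (@rpred_horner L (genfield _)); last first.
  by apply: genW; right; rewrite inE eqxx.
apply/polyOverP=> i; rewrite !coef_map /=; apply: genW; left; exists t`_i.
by rewrite -baseField_scaleE.
Qed.

Theorem splitting_field_exists (F : fieldType) (p : {poly F}) : p != 0 ->
  exists (L : splittingFieldType F) (zs : seq L),
    map_poly (in_alg L) p %= \prod_(z <- zs) ('X - z%:P) /\
    forall y, y \in genfield (base_or_root zs).
Proof.
move=> /splits_ext[L [zs [Dzs genL]]].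
have ax : splitting_field_axiom L.
  exists (map_poly (in_alg L) p).
    by apply/polyOver1P; exists p.
  exists zs => //; apply/eqP; rewrite eqEsubv subvf; apply/subvP=> y _.
  have /genpP := genL y; elim=> {y}.
  - move=> y [[c ->]|yzs]; last exact: seqv_sub_adjoin.
    by rewrite memvZ ?mem1v.
  - exact: mem1v.
  - by move=> y z _ Ly _ Lz; apply: rpredB.
  - by move=> y z _ Ly _ Lz; apply: rpredM.
  - by move=> y _ Ly; rewrite memvV.
by exists (splitting_pack ax), zs.
Qed.
End SplittingField.

(** * Polynomial rings are integrally closed *)

Section IntegrallyClosed.
Variables (k E : fieldType) (j : {rmorphism {poly k} -> E}).
Hypothesis jI : injective j.

(** The denominator of a reduced fraction that is integral divides a power of the
    numerator, hence is constant. *)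
Lemma poly_integrally_closed p q : q != 0 -> integralOver j (j p / j q) ->
  exists r, j p / j q = j r.
Proof.
move=> nzq; have j_nz r : r != 0 -> j r != 0 by rewrite -(inj_eq jI) rmorph0.
pose d := gcdp p q; pose p' := p %/ d; pose q' := q %/ d.
have nzd : d != 0 by rewrite gcdp_eq0 negb_and nzq orbT.
have Dp : p = p' * d by rewrite divpK ?dvdp_gcdl.
have Dq : q = q' * d by rewrite divpK ?dvdp_gcdr.
have nzq' : q' != 0 by apply: contraNneq nzq => e; rewrite Dq e mul0r.
have cop : coprimep q' p'.
  by rewrite coprimep_sym coprimep_div_gcd // nzq orbT.
have -> : j p / j q = j p' / j q'.
  by rewrite Dp Dq !rmorphM -mulf_div divff ?mulr1 // j_nz.
case=> P mP; set n := (size P).-1; have szP : size P = n.+1.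
  by rewrite /n prednK // size_poly_gt0 monic_neq0.
rewrite /root horner_coef size_map_inj_poly ?rmorph0 // szP => /eqP Pz.
have : \sum_(i < n.+1) P`_i * p' ^+ i * q' ^+ (n - i) = 0.
  apply: jI; rewrite rmorph0 rmorph_sum /=; transitivity (0 * j q' ^+ n); last exact: mul0r.
  rewrite -[X in _ = X * _]Pz mulr_suml.
  apply: eq_bigr => i _; rewrite coef_map /= !rmorphM !rmorphXn.
  rewrite expr_div_n -!mulrA; do 2!congr (_ * _).
  have le_in : (i <= n)%N by rewrite -ltnS.
  by rewrite [LHS]expfB_cond ?(negPf (j_nz _ nzq')) // mulrC.
rewrite big_ord_recr /= subnn expr0 mulr1 (_ : P`_n = 1); last first.
  by rewrite /n -lead_coefE (monicP mP).
rewrite mul1r => /eqP; rewrite addrC addr_eq0 => /eqP pn.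
have : q' %| p' ^+ n.
  rewrite pn dvdpNr; apply: (big_ind (fun u => q' %| u)) => [|u v qu qv|i _]; first exact: dvdp0.
    by rewrite dvdp_add.
  by rewrite dvdp_mull // -(subnSK (ltn_ord i)) exprS dvdp_mulr.
rewrite -[p' ^+ n]mul1r => qpn.
have /eqP sz1 : size q' == 1.
  by rewrite -dvdp1; move: qpn; rewrite Gauss_dvdpl // coprimep_expr.
have [c /negPf nzc Dc] := size_poly1P _ (introT eqP sz1).
exists (c^-1 *: p'); apply: (canLR (mulfK _)); first by rewrite j_nz.
by rewrite -rmorphM Dc mulrC mul_polyC scalerA mulfV ?scale1r // nzc.
Qed.
End IntegrallyClosed.

(** * Root transpositions of the generic trinomial *)

Lemma trinomial_root (L : fieldType) (a b : L) (x : 'I_8 -> L) :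
    'X^8 + a *: 'X + b%:P = \prod_i ('X - (x i)%:P) ->
  forall m, x m ^+ 8 + a * x m + b = 0.
Proof.
move=> Dx m; transitivity ('X^8 + a *: 'X + b%:P).[x m]; first by rewrite !hornerE.
by rewrite Dx; apply/rootP; rewrite (bigD1 m) //= rootM root_XsubC eqxx.
Qed.

Section Transposition.
Variables (K : fieldType) (L : splittingFieldType K) (a b : L) (x : 'I_8 -> L).
Hypothesis ch0 : [pchar L] =i pred0.
Hypothesis base_gen : forall c : K, (c%:A : L) \in genfield (fun z => z = a \/ z = b).
Hypothesis x_gen :
  forall z : L, z \in genfield (fun z => (exists c : K, z = c%:A) \/ exists i, z = x i).
Hypotheses (a_base : a \in 1%VS) (b_base : b \in 1%VS).
Hypothesis ab_ind : independent (fun _ => False) [:: a; b].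
Hypothesis Dx : 'X^8 + a *: 'X + b%:P = \prod_i ('X - (x i)%:P).

Let nat_nz n : n.+1%:R != 0 :> L.
Proof. by rewrite (proj1 (pcharf0P _) ch0). Qed.

Let ab_steinitz (t : seq L) : size t = 2%N ->
  a \in genfield (adjoins (fun _ => False) t) -> b \in genfield (adjoins (fun _ => False) t) ->
  independent (fun _ => False) t.
Proof.
move=> sz ta tb; apply: ind_steinitz ab_ind _ => // z.
by rewrite !inE => /orP[] /eqP->; apply: gen_alg.
Qed.

(** A double root [r] would determine both [a = - 8 r^7] and [b = 7 r^8], against
    their independence. *)
Lemma trinomial_inj : injective x.
Proof.
move=> i l e; apply/eqP/negPn/negP => nil.
have da : 8%:R * x i ^+ 7 + a = 0.
  transitivity ('X^8 + a *: 'X + b%:P)^`().[x i].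
    by rewrite !derivE addr0 hornerD hornerMn hornerXn hornerZ hornerC mulr1 mulr_natl.
  rewrite Dx (bigD1 i) //= (bigD1 l) 1?eq_sym //= -e derivM hornerD !hornerM.
  by rewrite !hornerXsubC subrr !(mul0r, mulr0) addr0.
(* The constant 1 makes a family of the length of [:: a; b], and is algebraic. *)
have xg : x i \in genfield (adjoins (fun _ => False) [:: x i; 1]).
  by apply/genW/adjsE; right; rewrite mem_head.
have ag : a \in genfield (adjoins (fun _ => False) [:: x i; 1]).
  have -> : a = - (8%:R * x i ^+ 7) by apply/eqP; rewrite -addr_eq0 addrC da.
  by rewrite rpredN rpredM ?rpred_nat ?rpredX.
have bg : b \in genfield (adjoins (fun _ => False) [:: x i; 1]).
  have -> : b = - (x i ^+ 8 + a * x i).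
    by apply/eqP; rewrite -addr_eq0 addrC (trinomial_root Dx).
  by rewrite rpredN rpredD ?rpredM ?rpredX.
by case: (@ab_steinitz [:: x i; 1] erefl ag bg) => _ [na _]; apply/na/alg1.
Qed.

Let gal1L : galois 1 {:L}.
Proof.
rewrite /galois sub1v normalFieldf andbT /=.
by apply/separableP => z _; apply: pcharf0_separable.
Qed.

Variables i l : 'I_8.
Hypothesis neq_il : i != l.

Let y := (x i + x l) / 2%:R.
Let h := (x i - x l) / 2%:R.
Let W := h ^+ 2.

Let two_nz : 2%:R != 0 :> L := nat_nz 1.
Let xiE : x i = y + h. Proof. by rewrite /y /h; field. Qed.
Let xlE : x l = y - h. Proof. by rewrite /y /h; field. Qed.

Let h_nz : h != 0.
Proof.
rewrite mulf_neq0 ?invr_eq0 // subr_eq0; apply: contra neq_il => /eqP e.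
by apply/eqP/trinomial_inj.
Qed.

Let aE : a = - (8%:R * y ^+ 7 + 56%:R * y ^+ 5 * W + 56%:R * y ^+ 3 * W ^+ 2
                + 8%:R * y * W ^+ 3).
Proof.
have e1 := (trinomial_root Dx) i; have e2 := (trinomial_root Dx) l.
rewrite xiE in e1; rewrite xlE in e2.
apply: (mulfI (mulf_neq0 two_nz h_nz)).
apply/eqP; rewrite -subr_eq0; apply/eqP; rewrite /W.
transitivity (((y + h) ^+ 8 + a * (y + h) + b) - ((y - h) ^+ 8 + a * (y - h) + b)).
  by ring.
by rewrite e1 e2 subrr.
Qed.

Let bE : b = (y ^+ 2 - W) * (7%:R * y ^+ 6 + 35%:R * y ^+ 4 * W
              + 21%:R * y ^+ 2 * W ^+ 2 + W ^+ 3).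
Proof.
have e1 := (trinomial_root Dx) i; rewrite xiE in e1.
apply/eqP; rewrite -subr_eq0; apply/eqP; rewrite -[RHS]e1 aE /W; ring.
Qed.

Let yW_gen (z : L) : z = a \/ z = b -> z \in genfield (adjoin (adjoin (fun _ => False) y) W).
Proof.
have gy : y \in genfield (adjoin (adjoin (fun _ => False) y) W).
  by apply: genW; left; right.
have gW : W \in genfield (adjoin (adjoin (fun _ => False) y) W) by apply: genW; right.
by case=> ->; rewrite ?aE ?bE; repeat first
  [ assumption | exact: rpred_nat | apply: rpredD | apply: rpredM | apply: rpredB
  | rewrite rpredN | apply: rpredX ].
Qed.

(** [a] and [b] are polynomials in [y] and [W], so the latter are independent:
    the field [Q(y, W)] is rational and [W] is a prime element of [Q(y)[W]]. *)
Let yW_ind : independent (fun _ => False) [:: y; W].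
Proof. by apply: ab_steinitz => //; apply: yW_gen; [left | right]. Qed.

Let S0 := adjoin (fun _ => False) y.
Let y_gen : y \in genfield S0. Proof. by apply: genW; right. Qed.

Let y_nz : y != 0.
Proof.
case: yW_ind => ny _; apply: contra_notN ny => /eqP->.
by apply: gen_alg; rewrite rpred0.
Qed.

Let vk : {rmorphism genfield_type S0 -> L} := (val : genfield_type S0 -> L).
Let com : commr_rmorph vk W. Proof. by move=> c; apply: mulrC. Qed.
Let j : {rmorphism {poly genfield_type S0} -> L} := horner_morph com.

Let jE p : j p = (map_poly vk p).[W]. Proof. by []. Qed.

Let jI : injective j.
Proof.
move=> p q e; apply/eqP; rewrite -subr_eq0; set d := p - q.
have : j d = 0 by rewrite rmorphB e subrr.
rewrite jE => d0; case: yW_ind => _ [nW _]; apply: contra_notT nW => nzd.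
by exists (map_poly vk d); rewrite polyOver_val val_poly_eq0 /root d0.
Qed.

Let jX : j 'X = W. Proof. exact: horner_morphX. Qed.
Let W_nz : W != 0. Proof. exact: expf_neq0. Qed.

Local Notation int := (integralOver j).

Let int_gen c : c \in genfield S0 -> int c.
Proof.
move=> Sc; have -> : c = j (Genfield Sc)%:P by rewrite jE map_polyC hornerC.
exact: integral_id.
Qed.

Let int_nat n : int n%:R. Proof. exact: integral_nat. Qed.
Let int_y : int y. Proof. exact: int_gen. Qed.
Let int_W : int W. Proof. by rewrite -jX; apply: integral_id. Qed.
Let int1 : int 1. Proof. exact: integral1. Qed.
Let intX u n : int u -> int (u ^+ n).
Proof.
by move=> iu; elim: n => [|n IHn]; rewrite ?expr0 ?exprS; [|apply: integral_mul].
Qed.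
Let int_prod (I : Type) (r : seq I) (P : pred I) (F : I -> L) :
  (forall i, P i -> int (F i)) -> int (\prod_(i <- r | P i) F i).
Proof. by move=> iF; apply: big_ind => //; apply: integral_mul. Qed.
Let int_sum (I : Type) (r : seq I) (P : pred I) (F : I -> L) :
  (forall i, P i -> int (F i)) -> int (\sum_(i <- r | P i) F i).
Proof. by move=> iF; apply: big_ind => //; [apply: integral0 | apply: integral_add]. Qed.

Ltac integral := repeat first
  [ assumption | exact: int_nat | exact: int1 | apply: integral_add
  | apply: integral_mul | apply: integral_sub | apply: integral_opp | apply: intX
  | exact: int_y | exact: int_W ].

Let int_a : int a. Proof. by rewrite aE; integral. Qed.
Let int_b : int b. Proof. by rewrite bE; integral. Qed.

Let int_x m : int (x m).
Proof.
apply: (@integral_root_monic _ _ _ _ ('X^8 + a *: 'X + b%:P)).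
- by rewrite Dx; apply: monic_prod_XsubC.
- by apply/rootP; rewrite !hornerE (trinomial_root Dx).
- apply/integral_poly => n; rewrite !coefD coefZ coefXn coefX coefC.
  apply: integral_add; first apply: integral_add => //.
    by apply: integral_mul.
  by case: eqP => _ //; apply: integral0.
Qed.

Let int_h : int h.
Proof.
have -> : h = x i - y by rewrite xiE addrC addKr.
exact: integral_sub.
Qed.

Let M0 := <<<<1; y>>; W>>%AS.
Local Notation G0 := 'Gal({:L} / M0)%g.

Let sM0 : (M0 <= {:L})%VS. Proof. exact: subvf. Qed.
Let galM0 : galois M0 {:L}.
Proof. by apply: galoisS gal1L; rewrite sub1v subvf. Qed.

Let y_M0 : y \in M0. Proof. by rewrite /= subvP_adjoin // memv_adjoin. Qed.
Let W_M0 : W \in M0. Proof. exact: memv_adjoin. Qed.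

Let genp_M0 c : c \in genfield S0 -> c \in M0.
Proof.
move=> /genpP; elim=> {c} [c [[]|->]||u v _ Mu _ Mv|u v _ Mu _ Mv|u _ Mu] //.
- exact: mem1v.
- exact: rpredB.
- exact: rpredM.
- by rewrite memvV.
Qed.

Let j_M0 p : j p \in M0.
Proof.
rewrite jE; apply: rpred_horner => //; apply/polyOverP=> n; rewrite coef_map.
exact: genp_M0 (valP p`_n).
Qed.

Let M0_frac z : z \in M0 -> exists p q, q != 0 /\ z = j p / j q.
Proof.
move=> Mz; have gz : z \in genfield (adjoin S0 W).
  have /Fadjoin_polyP[p /polyOverP pM ->] := Mz.
  apply: rpred_horner; last by apply: genW; right.
  apply/polyOverP=> n; have /Fadjoin_polyP[q /polyOverP qM ->] := pM n.
  apply: rpred_horner; last by apply: genW; left; right.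
  apply/polyOverP=> n'; have /vlineP[c ->] := qM n'.
  exact: genp_mono yW_gen _ (base_gen c).
have [_ [_ [/polyOver_lift[p <-] /polyOver_lift[q <-] qW ->]]] := gen_adjP gz.
exists p, q; split=> //; apply: contraNneq qW => ->.
by rewrite raddf0 horner0.
Qed.

Let M0_int z : z \in M0 -> int z -> exists p, z = j p.
Proof.
by move=> /M0_frac[p [q [nzq ->]]] intz; apply: poly_integrally_closed.
Qed.

Let gal_fix s z : s \in G0 -> z \in M0 -> s z = z.
Proof. by move=> Gs Mz; apply: fixed_gal Gs Mz. Qed.

Let gal_int s v : s \in G0 -> int v -> int (s v).
Proof.
move=> Gs [p mp /(rmorph_root s) rp]; exists p => //.
move: rp; rewrite -map_poly_comp (eq_map_poly (g := j)) // => q /=.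
exact: (gal_fix Gs (j_M0 q)).
Qed.

Let gal_h s : s \in G0 -> s h = h \/ s h = - h.
Proof.
move=> Gs; have : s h ^+ 2 = h ^+ 2 by rewrite -rmorphXn /=; apply: gal_fix.
by move/eqP; rewrite eqf_sqr => /orP[] /eqP; [left | right].
Qed.

(** The trace of a multiple of [h] is divisible by [W]: it is [h] times an
    integral element, so its square is divisible by [W] in [Q(y)[W]]. *)
Let trace_div v : int v ->
  exists2 c, int c & \sum_(s in G0) s v * s h = W * c.
Proof.
move=> iv; set t := \sum_(s in G0) _.
have tM : t \in M0.
  have -> : t = galTrace M0 {:L} (v * h).
    by apply: eq_bigr => s _; exact/esym/rmorphM.
  by apply: mem_galTrace; rewrite // memvf.
pose e s : L := if s h == h then 1 else -1.
have De s : s \in G0 -> s h = e s * h.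
  rewrite /e => /gal_h[] ->; rewrite ?eqxx ?mul1r //.
  by case: eqP => [{2}<-|_]; rewrite ?mul1r ?mulN1r.
pose u := \sum_(s in G0) s v * e s.
have tu : t = h * u.
  rewrite mulr_sumr; apply: eq_bigr => s Gs; rewrite De //; ring.
have iu : int u.
  apply: int_sum => s Gs; apply: integral_mul; first exact: gal_int.
  by rewrite /e; case: ifP => _ //; apply: integral_opp.
have [p Dp] : exists p, t = j p.
  by apply: M0_int => //; rewrite tu; apply: integral_mul.
have [q Dq] : exists q, u ^+ 2 = j q.
  apply: M0_int; last exact: intX.
  have -> : u ^+ 2 = t ^+ 2 / W by rewrite tu exprMn mulrC mulKf.
  by rewrite rpredM ?rpredX ?memvV.
have : p ^+ 2 = 'X * q.
  by apply: jI; rewrite rmorphXn rmorphM /= -Dp -Dq jX tu exprMn.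
move=> pq; have /factor_theorem[r Dr] : root p 0.
  by rewrite /root -sqrf_eq0 -horner_exp pq hornerM hornerX mul0r.
exists (j r); first exact: integral_id.
by rewrite Dp Dr subr0 rmorphM /= jX mulrC.
Qed.

(** The factors [d (x m) - s (x m)], with [m] depending on [d], are there to kill
    the terms of the trace with [s] in [r].  They preserve the divisibility by [W],
    as [v] is arbitrary: each one is a difference of two multiples, by
    [d (x m)] outside and by [x m] inside the trace. *)
Let trace_div_prod (r : seq (gal_of {:L})) (m : gal_of {:L} -> 'I_8) v :
  {subset r <= G0} -> int v ->
  exists2 c, int c &
    \sum_(s in G0) (\prod_(d <- r) (d (x (m d)) - s (x (m d)))) * s v * s h = W * c.
Proof.
elim: r v => [|d r IHr] v sr iv.
  have [c ic Dc] := trace_div iv; exists c => //; rewrite -Dc.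
  by apply: eq_bigr => s _; rewrite big_nil mul1r.
have {}sr' : {subset r <= G0} by move=> s rs; apply: sr; rewrite inE rs orbT.
have id : int (d (x (m d))) by apply: gal_int => //; apply/sr/mem_head.
have [c1 i1 D1] := IHr _ sr' iv.
have [c2 i2 D2] := IHr _ sr' (integral_mul (int_x (m d)) iv).
exists (d (x (m d)) * c1 - c2); first by apply: integral_sub => //; apply: integral_mul.
rewrite mulrBr mulrCA -D1 -D2 mulr_sumr -sumrB; apply: eq_bigr => s _.
by rewrite big_cons rmorphM; ring.
Qed.

Let unit_mod_W u := exists v z, [/\ int v, int z & u * v = 1 + W * z].

Let unit_modM u1 u2 : unit_mod_W u1 -> unit_mod_W u2 -> unit_mod_W (u1 * u2).
Proof.
move=> [v1 [z1 [iv1 iz1 e1]]] [v2 [z2 [iv2 iz2 e2]]].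
exists (v1 * v2), (z1 + z2 + W * (z1 * z2)); split; try by integral.
by rewrite mulrACA e1 e2; ring.
Qed.

(** Modulo [W] the trinomial is [X^8 - 8 y^7 X + 7 y^8], for which [y] is the only
    multiple root, and a double one.  So the derivative at [x m] is a unit, and its
    factor [x m - x m'] is one too. *)
Let diff_unit m m' : m != i -> m != l -> m' != m -> unit_mod_W (x m - x m').
Proof.
move=> mi ml m'm.
(* 1568 = 56 * 28: modulo [W], with [x = x m] and [f] the trinomial,
   [x f'(x) = 56 y^7 (x - y)] and [(y - x) g' = 28 y^6]. *)
pose c := 1568%:R * y ^+ 13.
have c_nz : c != 0 by rewrite mulf_neq0 ?expf_neq0.
have ic : int c^-1 by apply: int_gen; rewrite rpredV rpredM ?rpred_nat ?rpredX.
pose g' := \prod_(n | (n != i) && (n != l) && (n != m)) (y - x n).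
pose g := (y - x m) * g'.
have Dg : g = 28%:R * y ^+ 6 + 70%:R * y ^+ 4 * W + 28%:R * y ^+ 2 * W ^+ 2 + W ^+ 3.
  apply: (mulfI (_ : - W != 0)); first by rewrite oppr_eq0.
  transitivity (('X^8 + a *: 'X + b%:P).[y]).
    rewrite Dx horner_prod (bigD1 i) //= (bigD1 l) 1?eq_sym //=.
    rewrite (bigD1 m) ?mi //= !hornerXsubC [RHS]mulrA; congr (_ * (_ * _)).
      by rewrite xiE xlE /W; ring.
    by apply: eq_bigr => n _; rewrite hornerXsubC.
  by rewrite !hornerD hornerXn hornerZ hornerX hornerC aE bE; ring.
pose D' := \prod_(n | (n != m) && (n != m')) (x m - x n).
have DD : 8%:R * x m ^+ 7 + a = (x m - x m') * D'.
  transitivity ('X^8 + a *: 'X + b%:P)^`().[x m].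
    by rewrite !derivE addr0 hornerD hornerMn hornerXn hornerZ hornerC mulr1 mulr_natl.
  rewrite Dx (bigD1 m) //= derivM hornerD !hornerM derivXsubC hornerC mul1r.
  rewrite hornerXsubC subrr mul0r addr0 (bigD1 m') //= hornerM hornerXsubC.
  by congr (_ * _); rewrite horner_prod; apply: eq_bigr => n _; rewrite hornerXsubC.
have ig' : int g' by apply: int_prod => n _; apply: integral_sub.
have iD' : int D' by apply: int_prod => n _; apply: integral_sub.
have Dm : x m * (8%:R * x m ^+ 7 + a) = - 7%:R * a * x m - 8%:R * b.
  apply/eqP; rewrite -subr_eq0; apply/eqP.
  transitivity (8%:R * (x m ^+ 8 + a * x m + b)); first by ring.
  by rewrite (trinomial_root Dx) mulr0.
pose q1 := 392%:R * y ^+ 5 + 392%:R * y ^+ 3 * W + 56%:R * y * W ^+ 2.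
pose q2 := 168%:R * y ^+ 6 + 504%:R * y ^+ 4 * W + 216%:R * y ^+ 2 * W ^+ 2
           + 8%:R * W ^+ 3.
pose q3 := 70%:R * y ^+ 4 + 28%:R * y ^+ 2 * W + W ^+ 2.
exists (D' * x m * - g' * c^-1).
exists ((56%:R * y ^+ 7 * q3 - q1 * (x m - y) * g' - q2 * g') * c^-1).
split.
- by do !apply: integral_mul => //; apply: integral_opp.
- apply: integral_mul => //; rewrite /q1 /q2 /q3.
  have ixm := int_x m; by integral.
rewrite !mulrA.
have -> : (x m - x m') * D' * x m * - g'
        = c + W * (56%:R * y ^+ 7 * q3 - q1 * (x m - y) * g' - q2 * g').
  rewrite -DD [_ * x m]mulrC Dm.
  transitivity (56%:R * y ^+ 7 * g - W * (q1 * (x m - y) * g' + q2 * g')).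
    by rewrite aE bE /g /q1 /q2; ring.
  by rewrite Dg /q3 /c; ring.
by rewrite mulrDl divff // -!mulrA.
Qed.

(** Suppose that every nontrivial automorphism [s] over Q(y, W) moves some root
    [x m] besides [x i] and [x l].  Then [trace_div_prod], with all these [s] in
    the product, leaves a single term: [h] times a product of differences that are
    units modulo [W] is a multiple of [W = h^2], which makes [W] invertible in
    Q(y)[W]. *)
Lemma trinomial_transposition :
  exists2 s, s \in 'Gal({:L} / 1)%g & forall m, s (x m) = x (tperm i l m).
Proof.
have sub1 z : z \in 1%VS -> z \in M0 by apply/subvP/sub1v.
have perm_root s m : s \in G0 -> exists m', s (x m) = x m'.
  move=> Gs; have sa : s a = a by apply: gal_fix => //; apply: sub1.
  have sb : s b = b by apply: gal_fix => //; apply: sub1.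
  have : root (\prod_i ('X - (x i)%:P)) (s (x m)).
    rewrite -Dx /root !hornerD hornerXn hornerZ hornerX hornerC.
    rewrite -{1}sa -{1}sb -[X in X + _ + _]rmorphXn -rmorphM -!rmorphD /=.
    by rewrite (trinomial_root Dx) rmorph0.
  rewrite /root horner_prod prodf_seq_eq0 => /hasP[m' _ /=].
  by rewrite hornerXsubC subr_eq0 => /eqP->; exists m'.
have gal_eq1 s : s \in G0 -> (forall m, s (x m) = x m) -> s = 1%g.
  move=> Gs sx; apply/eqP/gal_eqP => z _; rewrite gal_id.
  pose sr : {rmorphism L -> L} := s.
  apply: (@gen_ext _ _ sr idfun _ _ (x_gen z)) => _ [[c ->]|[m ->]] /=; last exact: sx.
  by apply: gal_fix => //; apply: sub1; rewrite memvZ ?mem1v.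
have sG0 s : s \in G0 -> s \in 'Gal({:L} / 1)%g by apply/subsetP/galS/sub1v.
have [[s Gs [sx nts]]|nomove] := pselect (exists2 s, s \in G0 &
    (forall m, m != i -> m != l -> s (x m) = x m) /\ s != 1%g).
  exists s; first exact: sG0.
  have sy : s y = y by apply: gal_fix.
  have [hh|hN] := gal_h Gs.
    case/negP: nts; apply/eqP/gal_eq1 => // m.
    have [->|mi] := eqVneq m i; first by rewrite xiE rmorphD /= sy hh.
    have [->|ml] := eqVneq m l; first by rewrite xlE rmorphB /= sy hh.
    exact: sx.
  move=> m; case: tpermP => [->|->|/eqP mi /eqP ml]; last exact: sx.
    by rewrite {1}xiE xlE rmorphD /= hN sy.
  by rewrite {1}xlE xiE rmorphB /= hN sy opprK.
exfalso.
have /boolp.choice[mv mvP] : forall s, exists m,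
    s \in G0 -> s != 1%g -> [/\ m != i, m != l & s (x m) != x m].
  move=> s; apply: contrapT => nm; apply: nomove.
  have [Gs nts] : s \in G0 /\ s != 1%g.
    by split; apply: contrapT => ns; apply: nm; exists i => Gs nts; case: ns.
  exists s => //; split=> // m mi ml; apply/eqP/negPn/negP => ns.
  by apply: nm; exists m.
pose r := [seq s <- enum G0 | s != 1%g].
have rG : {subset r <= G0}.
  by move=> s; rewrite mem_filter mem_enum => /andP[].
have [c ic Dc] := trace_div_prod mv rG int1.
pose P := \prod_(d <- r) (d (x (mv d)) - x (mv d)).
have DP : P * h = W * c.
  rewrite -Dc (bigD1 1%g) //= [X in _ + X]big1 ?addr0 => [|s /andP[Gs nts]].
    rewrite !gal_id mulr1; congr (_ * _); apply: eq_bigr => d _.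
    by rewrite gal_id.
  rewrite (big_rem s) /=; last by rewrite mem_filter nts mem_enum.
  by rewrite subrr !mul0r.
have [v [z [iv iz Dv]]] : unit_mod_W P.
  rewrite /P big_seq; apply: (big_ind unit_mod_W) => [|//|d].
    by exists 1, 0; split=> //; [apply: integral0 | rewrite mulr0 addr0 mulr1].
  rewrite mem_filter mem_enum => /andP[ntd Gd].
  have [mi ml neq] := mvP d Gd ntd; have [m' Dm'] := perm_root d (mv d) Gd.
  have [v [z [iv iz Dv]]] : unit_mod_W (x (mv d) - x m').
    by apply: diff_unit => //; apply: contraNneq neq => e; rewrite Dm' e.
  exists (- v), z; split=> //; first exact: integral_opp.
  by rewrite Dm' mulrN -mulNr opprB.
have e : (1 + W * z) * h = W * (c * v) by rewrite -Dv mulrAC DP mulrA.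
have e2 : (1 + W * z) ^+ 2 = W * (c * v) ^+ 2.
  apply: (mulIf W_nz); rewrite {2}/W -exprMn e; ring.
have /M0_int[|p Dp] : W^-1 \in M0 by rewrite memvV.
  have -> : W^-1 = (c * v) ^+ 2 - 2%:R * z - W * z ^+ 2.
    apply: (mulfI W_nz); rewrite divff //; move/eqP: e2; rewrite -subr_eq0 => /eqP e2.
    apply/eqP; rewrite -subr_eq0 -e2; apply/eqP; ring.
  by have icv := integral_mul ic iv; integral.
have /jI/(congr1 (horner^~ 0)) : j ('X * p) = j 1.
  by rewrite rmorph1 rmorphM /= jX -Dp divff.
by rewrite hornerM hornerX mul0r hornerC => /eqP; rewrite eq_sym oner_eq0.
Qed.
End Transposition.

(** * Independence of variables *)

Lemma rat_gen (E : fieldType) (f : {rmorphism rat -> E}) S r : f r \in genfield S.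
Proof.
by rewrite -(divq_num_den r) fmorph_div !rmorph_int rpred_div ?rpred_int.
Qed.

Lemma genp_rmorph (E E' : fieldType) (f : {rmorphism E -> E'}) S S' :
  (forall s, S s -> f s \in genfield S') -> forall z, z \in genfield S -> f z \in genfield S'.
Proof.
move=> sub z /genpP; elim=> {z} [z /sub //||u v _ gu _ gv|u v _ gu _ gv|u _ gu].
- by rewrite rmorph1 rpred1.
- by rewrite rmorphB rpredB.
- by rewrite rmorphM rpredM.
- by rewrite fmorphV rpredV.
Qed.

Lemma ind_all (E : fieldType) (S : E -> Prop) l :
  (forall l1 x l2, l = l1 ++ x :: l2 -> ~ algebraic_over (adjoins S l1) x) -> independent S l.
Proof.
elim: l S => //= x l IHl S nalg; split; first exact: (nalg [::] x l).
by apply: IHl => l1 y l2 Dl; apply: (nalg (x :: l1) y l2); rewrite Dl.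
Qed.

Lemma ind_free (I : eqType) (E : fieldType) (S : E -> Prop) (X : I -> E) r :
    (forall i, ~ algebraic_over (fun s => S s \/ exists2 j, j != i & s = X j) (X i)) ->
  uniq r -> independent S (map X r).
Proof.
move=> nX Ur; apply: ind_all => l1 z l2 Dl alz.
have sz1 : (size l1 < size r)%N by rewrite -(size_map X) Dl size_cat /= addnS ltnS leq_addr.
case: r => [|i0 r'] in Ur Dl sz1 *; first by [].
set r := i0 :: r' in Ur Dl sz1; pose i := nth i0 r (size l1).
have Dz : z = X i.
  by rewrite -(nth_map i0 z) // Dl nth_cat ltnn subnn.
move: alz; rewrite Dz; apply: contra_not (nX i); apply: alg_mono => s.
case/adjsE=> [Ss|/(nthP z)[m ltm <-]]; first by left.
right; exists (nth i0 r m).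
  by rewrite nth_uniq ?(ltn_trans ltm) // neq_ltn ltm.
by rewrite -(nth_map i0 z) ?(ltn_trans ltm) // Dl nth_cat ltm.
Qed.

Lemma alg_rmorph (E E' : fieldType) (f : {rmorphism E -> E'}) S S' z :
  (forall s, S' s -> exists2 t, S t & s = f t) -> algebraic_over S' (f z) -> algebraic_over S z.
Proof.
move=> sub [p [/polyOverP Sp nzp rp]].
have lift s : s \in genfield S' -> exists2 t, t \in genfield S & s = f t.
  move=> /genpP; elim=> {s}.
  - by move=> s /sub[t St ->]; exists t => //; apply: genW.
  - by exists 1; rewrite ?rmorph1 ?rpred1.
  - by move=> _ _ _ [u Su ->] _ [v Sv ->]; exists (u - v); rewrite ?rmorphB ?rpredB.
  - by move=> _ _ _ [u Su ->] _ [v Sv ->]; exists (u * v); rewrite ?rmorphM ?rpredM.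
  - by move=> _ _ [u Su ->]; exists u^-1; rewrite ?fmorphV ?rpredV.
have /boolp.choice[c cP] : forall i, exists t, t \in genfield S /\ p`_i = f t.
  by move=> i; have [t St e] := lift _ (Sp i); exists t.
pose q := \poly_(i < size p) c i.
have Dq : map_poly f q = p.
  apply/polyP=> i; rewrite coef_map coef_poly; case: ltnP => [_|le].
    by case: (cP i) => _ ->.
  by rewrite raddf0 nth_default.
exists q; split.
- apply/polyOverP=> i; rewrite coef_poly; case: ifP => _; last exact: rpred0.
  by case: (cP i).
- by rewrite -(map_poly_eq0 f) Dq.
- by rewrite -(fmorph_root f) Dq.
Qed.

Lemma ind_rmorph (E E' : fieldType) (f : {rmorphism E -> E'}) S S' l :
  (forall s, S' s -> exists2 t, S t & s = f t) -> independent S l -> independent S' (map f l).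
Proof.
elim: l S S' => //= x l IHl S S' sub [nx indl]; split.
  by move/(alg_rmorph sub).
apply: IHl indl => s [/sub[t St ->]|->]; first by exists t => //; left.
by exists x => //; right.
Qed.

(** An equation of [x] over [S] would have all the translates of [x] as roots. *)
Lemma not_alg_translate (E : fieldType) (S : E -> Prop) (x : E) :
    [pchar E] =i pred0 ->
    (forall m, exists f : {rmorphism E -> E},
       (forall s, S s -> f s = s) /\ f x = x + m%:R) ->
  ~ algebraic_over S x.
Proof.
move=> ch0 tr [p [/polyOverP Sp nzp rp]].
pose rs := [seq x + m%:R | m <- iota 0 (size p)].
have : (size rs < size p)%N.
  apply: max_poly_roots => //.
    apply/allP=> _ /mapP[m _ ->]; have [f [fS <-]] := tr m.
    have -> : p = map_poly f p.
      by apply/polyP=> i; rewrite coef_map /= (@gen_ext _ S f idfun).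
    exact: rmorph_root.
  by rewrite map_inj_uniq ?iota_uniq // => m n /addrI/(natr_inj ch0).
by rewrite size_map size_iota ltnn.
Qed.

Section MpolyFraction.
Variables (k : fieldType) (n : nat).
Local Notation P := {mpoly k[n]}.

Lemma mpoly_frac_gen (z : {fraction P}) :
  z \in genfield (fun z => (exists c, z = (c%:MP)%:F) \/ exists i, z = ('X_i)%:F).
Proof.
have genP (p : P) :
    p%:F \in genfield (fun z => (exists c, z = (c%:MP)%:F) \/ exists i, z = ('X_i)%:F).
  rewrite [p]mpolyE rmorph_sum rpred_sum // => m _.
  rewrite -mul_mpolyC rmorphM rpredM //; first by apply: genW; left; exists p@_m.
  rewrite mpolyXE_id rmorph_prod rpred_prod // => i _.
  by rewrite rmorphXn rpredX // genW //; right; exists i.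
by have [p [q [_ ->]]] := fracE z; rewrite rpred_div.
Qed.

Lemma mpoly_frac_endo (f f' : {rmorphism P -> P}) : cancel f f' ->
  exists g : {rmorphism {fraction P} -> {fraction P}}, forall p, g p%:F = (f p)%:F.
Proof.
move=> fK; apply: (@frac_lift _ _ (@FracField.tofrac P \o f)) => p q /eqP.
by rewrite /= tofrac_eq => /eqP/(can_inj fK).
Qed.

Lemma mpoly_frac_pchar0 : [pchar k] =i pred0 -> [pchar {fraction P}] =i pred0.
Proof.
move=> ch0 i; pose h : {rmorphism k -> {fraction P}} := @FracField.tofrac P \o @mpolyC n k.
by rewrite (fmorph_pchar h).
Qed.

Lemma mpoly_frac_not_alg i : [pchar k] =i pred0 ->
  ~ algebraic_over (fun s => (exists c, s = (c%:MP)%:F) \/ exists2 j, j != i & s = ('X_j)%:F)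
      (('X_i : P)%:F).
Proof.
move=> ch0; apply: not_alg_translate => [|m]; first exact: mpoly_frac_pchar0.
pose f (c : k) : {rmorphism P -> P} :=
  mmap (@mpolyC n k) (fun j => 'X_j + ((j == i)%:R * c)%:MP).
have fK c : cancel (f c) (f (- c)).
  move=> p; apply: (@mpoly_ext _ _ _ (f (- c) \o f c) idfun) => [d|j] /=.
    by rewrite !mmapC.
  rewrite [X in f _ X](mmapX _ _ U_(j)) mmap1U rmorphD /= [X in _ + X]mmapC.
  by rewrite mmapX mmap1U -addrA -mpolyCD mulrN addNr mpolyC0 addr0.
have [g gE] := mpoly_frac_endo (fK m%:R).
exists g; split=> [_ [[c ->]|[j /negPf ji ->]]|].
- by rewrite gE /= mmapC.
- by rewrite gE /= mmapX mmap1U ji mul0r mpolyC0 addr0.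
- rewrite gE /= mmapX mmap1U eqxx mul1r rmorphD; congr (_ + _).
  by rewrite mpolyC_nat rmorph_nat.
Qed.
End MpolyFraction.

(** * The generic trinomial of degree 8 *)

(** Its group contains the transpositions of roots, which generate [S_8]. *)
Theorem trinomial_symmetric :
  exists (L : fieldType) (_ : {rmorphism rat -> L}) (a b : L) (x : 'I_8 -> L)
    (act : 'S_8 -> {rmorphism L -> L}),
  [/\ independent (fun _ => False) [:: a; b],
      'X^8 + a *: 'X + b%:P = \prod_i ('X - (x i)%:P),
      injective x,
      forall z, z \in genfield (fun z => z = a \/ z = b \/ exists i, z = x i)
    & forall s, [/\ act s a = a, act s b = b & forall i, act s (x i) = x (s i)]].
Proof.
pose P := {mpoly rat[2]}; pose K := {fraction P}.
pose a0 : K := ('X_ord0 : P)%:F; pose b0 : K := ('X_ord_max : P)%:F.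
have ch0 : [pchar rat] =i pred0 by apply: Num.Theory.pchar_num.
have ind0 : independent (fun _ : K => False) [:: a0; b0].
  have := @ind_free _ _ (fun _ => False) (fun i => ('X_i : P)%:F) [:: ord0; ord_max].
  apply=> // i al; apply: (@mpoly_frac_not_alg _ _ i ch0); apply: alg_mono al => s.
  by case=> //; right.
have gen0 (c : K) : c \in genfield (fun z => z = a0 \/ z = b0).
  apply: genp_mono (mpoly_frac_gen c) => _ [[r ->]|[i ->]].
    exact: (rat_gen (@FracField.tofrac P \o @mpolyC 2 rat)).
  apply: genW; case: i => -[|[|//]] lt; [left | right]; congr ('X__)%:F;
    exact: val_inj.
pose p : {poly K} := 'X^8 + a0 *: 'X + b0%:P.
have mp : p \is monic.
  rewrite /p -addrA monicE lead_coefDl ?lead_coefXn // size_polyXn.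
  rewrite (leq_ltn_trans (size_polyD _ _)) // gtn_max.
  rewrite (leq_ltn_trans (size_scale_leq _ _)) ?size_polyX //.
  by rewrite (leq_ltn_trans (size_polyC_leq1 _)).
have [L [zs [Dp genL]]] := splitting_field_exists (monic_neq0 mp).
pose a : L := a0%:A; pose b : L := b0%:A.
have Dzs : 'X^8 + a *: 'X + b%:P = \prod_(z <- zs) ('X - z%:P).
  have <- : map_poly (in_alg L) p = 'X^8 + a *: 'X + b%:P.
    by rewrite /p !rmorphD /= map_polyXn map_polyZ map_polyX map_polyC.
  apply/eqP; rewrite -eqp_monic // ?monic_map // monic_prod_XsubC //.
have szs : size zs = 8.
  apply/eqP; rewrite -eqSS -(size_prod_XsubC zs id) -Dzs -addrA size_polyDl size_polyXn //.
  rewrite (leq_ltn_trans (size_polyD _ _)) // gtn_max.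
  rewrite (leq_ltn_trans (size_scale_leq _ _)) ?size_polyX //.
  by rewrite (leq_ltn_trans (size_polyC_leq1 _)).
pose x (i : 'I_8) : L := zs`_i.
have Dx : 'X^8 + a *: 'X + b%:P = \prod_i ('X - (x i)%:P).
  by rewrite Dzs (big_nth 0) szs big_mkord.
have ch0L : [pchar L] =i pred0.
  move=> i; rewrite (fmorph_pchar (in_alg L)).
  exact: mpoly_frac_pchar0.
have base_gen (c : K) : (c%:A : L) \in genfield (fun z => z = a \/ z = b).
  apply: (genp_rmorph (f := in_alg L) _ (gen0 c)) => _ [] ->; apply: genW;
    by [left | right].
have x_gen (z : L) :
    z \in genfield (fun z => (exists c : K, z = c%:A) \/ exists i, z = x i).
  apply: genp_mono (genL z) => _ [[c ->]|/(nthP 0)[i lti <-]]; apply: genW.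
    by left; exists c.
  by right; rewrite szs in lti; exists (Ordinal lti).
have ab_ind : independent (fun _ => False) [:: a; b].
  by apply: (@ind_rmorph _ _ (in_alg L) _ _ [:: a0; b0]) ind0.
have [a1 b1] : a \in 1%VS /\ b \in 1%VS by rewrite !memvZ ?mem1v.
have tr := trinomial_transposition ch0L base_gen x_gen a1 b1 ab_ind Dx.
have /boolp.choice[g gP] (s : 'S_8) : exists g : gal_of {:L},
    g \in 'Gal({:L} / 1)%g /\ forall i, g (x i) = x (s i).
  have [ts -> ] := prod_tpermP s.
  elim: ts => [_|[i l] ts IHts] /=.
    exists 1%g; split=> [|i]; first exact: group1.
    by rewrite big_nil perm1 gal_id.
  case/andP=> neq_il /IHts[g [Gg gx]].
  have [t Gt tx] := tr i l neq_il.
  exists (t * g)%g; split=> [|m]; first exact: groupM.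
  by rewrite galM ?memvf // tx gx big_cons permM.
pose act (s : 'S_8) : {rmorphism L -> L} := g s.
pose q : {rmorphism rat -> L} := in_alg L \o (@FracField.tofrac P \o @mpolyC 2 rat).
exists L, q, a, b, x, act; split=> //.
- by move=> u v; apply: (trinomial_inj ab_ind Dx).
- move=> z; apply: genp_mono (x_gen z) => _ [[c ->]|[i ->]].
    apply: genp_mono (base_gen c) => _ [] ->; apply: genW; by [left | right; left].
  by apply: genW; right; right; exists i.
- move=> s; have [Gs sx] := gP s; split=> //=.
    exact: fixed_gal (sub1v _) Gs a1.
  exact: fixed_gal (sub1v _) Gs b1.
Qed.

(** * Generic variables *)

(** Permutations of the variables, combined with automorphisms of the constants,
    act on polynomials by invertible maps, hence on fractions. *)
Theorem generic_variables (k : fieldType) (I : finType) : [pchar k] =i pred0 ->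
  exists (E : fieldType) (iota : {rmorphism k -> E}) (X : I -> E),
  [/\ forall i, ~ algebraic_over
        (fun z => (exists c, z = iota c) \/ exists2 j, j != i & z = X j) (X i),
      forall z, z \in genfield (fun z => (exists c, z = iota c) \/ exists i, z = X i)
    & forall (f f' : {rmorphism k -> k}) (s : {perm I}), cancel f f' ->
      exists g : {rmorphism E -> E},
        (forall c, g (iota c) = iota (f c)) /\ (forall i, g (X i) = X (s i))].
Proof.
move=> ch0; pose P := {mpoly k[#|I|]}.
pose iota : {rmorphism k -> {fraction P}} := @FracField.tofrac P \o @mpolyC #|I| k.
pose X i : {fraction P} := ('X_(enum_rank i) : P)%:F.
exists {fraction P}, iota, X; split.
- move=> i al; apply: (@mpoly_frac_not_alg _ _ (enum_rank i) ch0).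
  apply: alg_mono al => z [[c ->]|[j ji ->]]; first by left; exists c.
  by right; exists (enum_rank j); rewrite // (inj_eq enum_rank_inj).
- move=> z; apply: genp_mono (mpoly_frac_gen z) => _ [[c ->]|[r ->]]; apply: genW.
    by left; exists c.
  by right; exists (enum_val r); rewrite /X enum_valK.
move=> f f' s fK.
pose F (h : {rmorphism k -> k}) (t : {perm I}) : {rmorphism P -> P} :=
  mmap (@mpolyC #|I| k \o h) (fun r => 'X_(enum_rank (t (enum_val r)))).
have FC h t c : F h t c%:MP = (h c)%:MP by rewrite /F /= mmapC.
have FX h t r : F h t 'X_r = 'X_(enum_rank (t (enum_val r))).
  by rewrite /F /= mmapX mmap1U.
have FK : cancel (F f s) (F f' s^-1%g).
  move=> p; apply: (@mpoly_ext _ _ _ (F f' s^-1%g \o F f s) idfun) => [c|r].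
    by change (F f' s^-1%g (F f s c%:MP) = c%:MP); rewrite !FC fK.
  change (F f' s^-1%g (F f s 'X_r) = 'X_r).
  by rewrite !FX enum_rankK permK enum_valK.
have [g gE] := mpoly_frac_endo FK; exists g; split=> [c|i].
  by change (g (c%:MP)%:F = ((f c)%:MP)%:F); rewrite gE FC.
by rewrite /X gE FX enum_rankK.
Qed.

(** * Criteria for algebraicity, and interpolation *)

Section AlgClosure.
Variable E : fieldType.
Implicit Types (S : E -> Prop) (z : E).

Lemma alg_genp S z : z \in genfield (algebraic_over S) -> algebraic_over S z.
Proof. exact: alg_gen. Qed.

Lemma alg_root S (q : {poly E}) z :
  q \is a polyOver (genfield (algebraic_over S)) -> q != 0 -> root q z -> algebraic_over S z.
Proof. by move=> Sq nzq rq; apply: (@alg_trans _ (algebraic_over S)) => //; exists q. Qed.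

Lemma ind_cat S l1 l2 : independent S l1 -> independent (adjoins S l1) l2 ->
  independent S (l1 ++ l2).
Proof.
elim: l1 S => [|x l1 IHl] S //= [nx ind1] ind2; split=> //; exact: IHl.
Qed.

(** With [P] the product of the [X - x l] for [l] other than [i], the combination
    of the weighted power sums with the coefficients of [P] is [w i * P.[x i]]. *)
Lemma weights_in_genp n (x w : 'I_n -> E) S i : injective x ->
  (forall l, x l \in genfield S) -> (forall k : 'I_n, \sum_l w l * x l ^+ k \in genfield S) ->
  w i \in genfield S.
Proof.
move=> xI Sx SJ; pose P := \prod_(l | l != i) ('X - (x l)%:P).
have SP : P \is a polyOver (genfield S).
  by rewrite rpred_prod // => l _; rewrite polyOverXsubC.
have szP : (size P <= n)%N.
  rewrite /P -big_filter size_prod_XsubC -sum1_size big_filter sum1_card cardC1 card_ord.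
  by rewrite prednK // (leq_ltn_trans _ (ltn_ord i)).
have Pi : P.[x i] != 0.
  rewrite horner_prod; apply/prodf_neq0 => l neq.
  by rewrite hornerXsubC subr_eq0 (inj_eq xI) eq_sym.
have Dw : w i * P.[x i] = \sum_(k < n) P`_k * \sum_l w l * x l ^+ k.
  transitivity (\sum_l w l * P.[x l]).
    rewrite (bigD1 i) //= [X in _ + X]big1 ?addr0 // => l neq.
    by rewrite horner_prod (bigD1 l) //= hornerXsubC subrr mul0r mulr0.
  rewrite (eq_bigr (fun l => \sum_(k < n) P`_k * (w l * x l ^+ k))).
    by rewrite exchange_big; apply: eq_bigr => k _; rewrite mulr_sumr.
  move=> l _; rewrite (horner_coef_wide _ szP) mulr_sumr.
  by apply: eq_bigr => k _; rewrite mulrCA.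
have -> : w i = w i * P.[x i] / P.[x i] by rewrite mulfK.
rewrite Dw rpred_div //; first by rewrite rpred_sum // => k _; rewrite rpredM ?(polyOverP SP).
by rewrite rpred_horner.
Qed.

End AlgClosure.

(** For each [u], the differences [A u (w i) - w i] are the coefficients of a
    polynomial of which [m] is a root if [A u] fixes the combination; [m] is chosen
    outside the roots of the finitely many nonzero ones. *)
Lemma primitive_combination (E : fieldType) (G I : finType)
    (A : G -> {rmorphism E -> E}) (w : I -> E) : [pchar E] =i pred0 ->
  exists m : nat, forall u, A u (\sum_i w i * m%:R ^+ enum_rank i)
      = \sum_i w i * m%:R ^+ enum_rank i -> forall i, A u (w i) = w i.
Proof.
move=> ch0; pose D u : {poly E} := \sum_i (A u (w i) - w i)%:P * 'X^(enum_rank i).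
have DE u i : (D u)`_(enum_rank i) = A u (w i) - w i.
  rewrite coef_sum (bigD1 i) //= coefCM coefXn eqxx mulr1 big1 ?addr0 // => j ji.
  by rewrite coefCM coefXn val_eqE (inj_eq enum_rank_inj) eq_sym (negPf ji) mulr0.
pose B := \prod_(u | D u != 0) D u.
have nzB : B != 0 by apply/prodf_neq0.
have /allPn[m _ nrm] : ~~ all (fun k => root B k%:R) (iota 0 (size B)).
  apply/negP=> rts; suff: (size [seq k%:R : E | k <- iota 0 (size B)] < size B)%N.
    by rewrite size_map size_iota ltnn.
  by apply: max_poly_roots; rewrite ?all_map ?(map_inj_uniq (natr_inj ch0)) ?iota_uniq.
exists m => u fz i; apply/eqP; rewrite -subr_eq0 -DE.
suff /eqP-> : D u == 0 by rewrite coef0.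
apply: contraNT nrm => nz; rewrite /B (bigD1 u) //= rootM; apply/orP; left.
rewrite /root horner_sum -subr_eq0 subr0; apply/eqP.
transitivity (A u (\sum_i w i * m%:R ^+ enum_rank i) - \sum_i w i * m%:R ^+ enum_rank i).
  rewrite rmorph_sum -sumrB; apply: eq_bigr => j _.
  by rewrite !hornerE rmorphM rmorphXn rmorph_nat mulrBl.
by rewrite fz subrr.
Qed.

(** Evaluation at independent elements is injective on polynomials, so it extends
    to fractions. *)
Lemma frac_mpoly_embedding (E : fieldType) (h : {rmorphism rat -> E}) (t : seq E) n :
  size t = n -> independent (fun _ => False) t ->
  exists f : {rmorphism {fraction {mpoly rat[n]}} -> E},
    (forall c, f c \in genfield (fun z => z \in t)) /\
    (forall z, z \in genfield (fun z => z \in t) -> exists c, z = f c).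
Proof.
move=> st indt; pose tt (i : 'I_n) := t`_i.
have Dt : [seq tt i | i <- enum 'I_n] = t.
  by rewrite (map_comp (fun k => t`_k)) val_enum_ord -st map_nth_iota0 ?take_size.
pose ev : {rmorphism {mpoly rat[n]} -> E} := mmap h tt.
have evI : injective ev.
  apply: raddf_inj => q; apply: (ind_mmap_inj (S := fun _ => False)).
    by move=> c; apply: rat_gen.
  by rewrite Dt.
have [f fE] := frac_lift evI; exists f; split=> [c|z /genpP].
  have [n' [d' [_ ->]]] := fracE c; rewrite fmorph_div !fE /=.
  by apply: rpred_div; apply: mmap_gen => [q|i]; rewrite ?rat_gen // genW // mem_nth ?st.
elim=> {z} [z zt||z1 z2 _ [c1 ->] _ [c2 ->]|z1 z2 _ [c1 ->] _ [c2 ->]|z _ [c ->]].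
- have lt : (index z t < n)%N by rewrite -st index_mem.
  exists (('X_(Ordinal lt) : {mpoly rat[n]})%:F).
  by rewrite fE /= mmapX mmap1U /tt nth_index.
- by exists 1; rewrite rmorph1.
- by exists (c1 - c2); rewrite rmorphB.
- by exists (c1 * c2); rewrite rmorphM.
- by exists c^-1; rewrite fmorphV.
Qed.

(** * The action on the oriented pieces of the cube *)

Local Notation facelet := ('I_8 * 'Z_3 + 'I_12 * 'Z_2)%type.
Local Notation cube := (Zwr 3 8 * Zwr 2 12)%type.

(** The orientation added is the one at the starting place [i], not at the target:
    this makes a right action for the group law of the wreath products. *)
Definition move (u : cube) (c : facelet) : facelet :=
  match c with
  | inl (i, s) => inl (wtop u.1 i, s + wbase u.1 i)
  | inr (j, s) => inr (wtop u.2 j, s + wbase u.2 j)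
  end.

Lemma moveM u v c : move (u * v)%g c = move v (move u c).
Proof.
by case: c => [[i s]|[i s]] /=; rewrite permM !ffunE addrA.
Qed.

Lemma move_inj u : injective (move u).
Proof.
apply: (can_inj (g := move u^-1%g)) => c; rewrite -moveM mulgV.
by case: c => [[i s]|[i s]] /=; rewrite perm1 !ffunE addr0.
Qed.

Section CubeAutomorphisms.

Variables (L : fieldType) (a b : L) (x : 'I_8 -> L).
Variable act : 'S_8 -> {rmorphism L -> L}.
Hypothesis L_gen : forall z, z \in genfield (fun z => z = a \/ z = b \/ exists i, z = x i).
Hypothesis actE :
  forall s, [/\ act s a = a, act s b = b & forall i, act s (x i) = x (s i)].

Variables (E : fieldType) (iota : {rmorphism L -> E}) (X : facelet -> E).
Hypothesis E_gen : forall z,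
  z \in genfield (fun z => (exists c, z = iota c) \/ exists i, z = X i).
Hypothesis X_perm : forall (f f' : {rmorphism L -> L}) (s : {perm facelet}),
  cancel f f' -> exists g : {rmorphism E -> E},
    (forall c, g (iota c) = iota (f c)) /\ (forall i, g (X i) = X (s i)).

Let act_ext (f g : {rmorphism L -> L}) : f a = g a -> f b = g b ->
  (forall i, f (x i) = g (x i)) -> f =1 g.
Proof.
move=> fga fgb fgx z; apply: (gen_ext _ (L_gen z)) => _ [->|[->|[i ->]]] //.
Qed.

Let actK s : cancel (act s) (act s^-1%g).
Proof.
have [sa sb sx] := actE s; have [ta tb tx] := actE s^-1%g.
apply: (act_ext (f := act s^-1%g \o act s) (g := idfun)) => [||i] /=.
- by rewrite sa.
- by rewrite sb.
- by rewrite sx tx permK.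
Qed.

Let actM s t z : act (s * t)%g z = act t (act s z).
Proof.
have [sa sb sx] := actE s; have [ta tb tx] := actE t.
have [ua ub ux] := actE (s * t)%g.
apply: (act_ext (g := act t \o act s)) => [||i] /=.
- by rewrite ua sa ta.
- by rewrite ub sb tb.
- by rewrite ux sx tx permM.
Qed.

(** An automorphism is determined by its effect on the constants and on the
    variables, so the composition rule follows from those of [act] and [move]. *)
Lemma cube_automorphisms : exists A : cube -> {rmorphism E -> E},
  [/\ forall u c, A u (iota c) = iota (act (wtop u.1) c),
      forall u i, A u (X i) = X (move u i)
    & forall u v e, A (u * v)%g e = A v (A u e)].
Proof.
have /boolp.choice[A AP] : forall u : cube, exists g : {rmorphism E -> E},
    (forall c, g (iota c) = iota (act (wtop u.1) c)) /\
    (forall i, g (X i) = X (move u i)).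
  move=> u; have [g [gc gX]] := X_perm (perm (@move_inj u)) (actK (wtop u.1)).
  by exists g; split=> // i; rewrite gX permE.
exists A; split=> [u c|u i|u v e]; [by case: (AP u) | by case: (AP u) |].
apply: (gen_ext (g := A v \o A u) _ (E_gen e)) => _ [[c ->]|[i ->]] /=.
  by rewrite !(proj1 (AP _)) actM.
by rewrite !(proj2 (AP _)) moveM.
Qed.

End CubeAutomorphisms.

(** * Invariants of the cube *)

Section RubikField.

Variables (L : fieldType) (a b : L) (x : 'I_8 -> L).
Variable act : 'S_8 -> {rmorphism L -> L}.
Hypothesis ab_ind : independent (fun _ => False) [:: a; b].
Hypothesis Dx : 'X^8 + a *: 'X + b%:P = \prod_i ('X - (x i)%:P).
Hypothesis xI : injective x.
Hypothesis L_gen : forall z, z \in genfield (fun z => z = a \/ z = b \/ exists i, z = x i).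
Hypothesis actE :
  forall s, [/\ act s a = a, act s b = b & forall i, act s (x i) = x (s i)].

Variables (E : fieldType) (iota : {rmorphism L -> E}) (X : facelet -> E).
Hypothesis ch0 : [pchar E] =i pred0.
Hypothesis X_free : forall i,
  ~ algebraic_over (fun z => (exists c, z = iota c) \/ exists2 j, j != i & z = X j) (X i).

Variable A : cube -> {rmorphism E -> E}.
Hypothesis A_iota : forall u c, A u (iota c) = iota (act (wtop u.1) c).
Hypothesis A_X : forall u i, A u (X i) = X (move u i).
Hypothesis A_M : forall u v e, A (u * v)%g e = A v (A u e).

Let tau i (s : 'Z_3) := X (inl (i, s)).
Let eta j (s : 'Z_2) := X (inr (j, s)).
(** Ratios of consecutive differences: up to scaling and translation, they carry
    the information on the three variables of a corner. *)
Let T i s := (tau i s - tau i (s + 1)) / (tau i (s + 1) - tau i (s + 2%:R)).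
Let d j s := eta j s - eta j (s + 1).

Let A_tau u i s : A u (tau i s) = tau (wtop u.1 i) (s + wbase u.1 i).
Proof. exact: A_X. Qed.
Let A_eta u j s : A u (eta j s) = eta (wtop u.2 j) (s + wbase u.2 j).
Proof. exact: A_X. Qed.

Let A_T u i s : A u (T i s) = T (wtop u.1 i) (s + wbase u.1 i).
Proof. by rewrite fmorph_div !rmorphB /= !A_tau /T !(addrAC _ _ (wbase u.1 i)). Qed.
Let A_d u j s : A u (d j s) = d (wtop u.2 j) (s + wbase u.2 j).
Proof. by rewrite rmorphB /= !A_eta /d (addrAC _ _ (wbase u.2 j)). Qed.

Let nat_nz n : n.+1%:R != 0 :> E.
Proof. by rewrite (proj1 (pcharf0P _) ch0). Qed.

Let others c z := (exists c', z = iota c') \/ exists2 c', c' != c & z = X c'.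

Let X_other c c' : c' != c -> X c' \in genfield (others c).
Proof. by move=> neq; apply: genW; right; exists c'. Qed.

Let X_notin c : X c \notin genfield (others c).
Proof. by apply/negP=> Xc; apply: (X_free (i := c)); apply: gen_alg. Qed.

Let X_neq c c' : c != c' -> X c - X c' != 0.
Proof.
move=> neq; rewrite subr_eq0; apply: contraNneq (X_notin c) => ->.
by apply: X_other; rewrite eq_sym.
Qed.

Let Z3P (P : 'Z_3 -> Prop) : P 0 -> P 1 -> P 2%:R -> forall s, P s.
Proof.
move=> P0 P1 P2 [[|[|[|//]]] lt]; [have <- : 0 = Ordinal lt | have <- : 1 = Ordinal lt
  | have <- : 2%:R = Ordinal lt] => //; exact: val_inj.
Qed.
Let Z2P (P : 'Z_2 -> Prop) : P 0 -> P 1 -> forall s, P s.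
Proof.
move=> P0 P1 [[|[|//]] lt]; [have <- : 0 = Ordinal lt | have <- : 1 = Ordinal lt]
  => //; exact: val_inj.
Qed.

Let tau_neq i s t : s != t -> tau i s - tau i t != 0.
Proof. by move=> neq; apply: X_neq; apply: contraNneq neq => -[->]. Qed.
Let s1 (s : 'Z_3) : s != s + 1. Proof. by move: s; apply: Z3P. Qed.
Let s2 (s : 'Z_3) : s + 1 != s + 2%:R. Proof. by move: s; apply: Z3P. Qed.
Let s3 (s : 'Z_3) : s != s + 2%:R. Proof. by move: s; apply: Z3P. Qed.

Let T_step i s : T i s + 1 != 0 /\ T i (s + 1) = - (T i s + 1)^-1.
Proof.
have e3 : s + 1 + 2%:R = s by move: s; apply: Z3P; apply: val_inj.
have e2 : s + 1 + 1 = s + 2%:R by rewrite -addrA.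
have := (tau_neq i (s1 s), tau_neq i (s2 s), tau_neq i (s3 s)).
rewrite /T e3 e2; move: (tau i s) (tau i (s + 1)) (tau i (s + 2%:R)) => p q r.
move=> [[pq qr] pr]; have e : (p - q) / (q - r) + 1 = (p - r) / (q - r) by field.
rewrite e; split; first by rewrite mulf_neq0 ?invr_eq0.
by rewrite invf_div; field; rewrite pr -opprB oppr_eq0 pr.
Qed.

Let Z3sum (V : nmodType) (F : 'Z_3 -> V) : \sum_s F s = F 0 + F 1 + F 2%:R.
Proof.
rewrite !big_ord_recl big_ord0 addr0 addrA.
by congr (F _ + F _ + F _); apply: val_inj.
Qed.

Let T_free i s : ~ algebraic_over (others (inl (i, s))) (T i s).
Proof.
move=> Ts; apply: (X_free (i := inl (i, s))); rewrite -/(others _).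
have neq (t : 'Z_3) : s != t -> inl (i, t) != inl (i, s) :> facelet.
  by apply: contraNneq => -[->].
have g1 := gen_alg (X_other (neq _ (s1 s))); have g2 := gen_alg (X_other (neq _ (s3 s))).
have -> : X (inl (i, s)) = T i s * (tau i (s + 1) - tau i (s + 2%:R)) - (0 - tau i (s + 1)).
  by rewrite /T divfK ?tau_neq // sub0r opprK subrK.
by apply: algB; [apply: algM => //; apply: algB | apply: algB => //; apply/gen_alg/rpred0].
Qed.

(** The roots of [Z^2 + Z + 1] are the fixed points of [Z |-> - 1 / (Z + 1)]. *)
Let T_quad i s : T i s ^+ 2 + T i s + 1 != 0.
Proof.
apply/eqP=> e; apply: (T_free (i := i) (s := s)).
exists ('X^2 + 'X + 1); split; last by rewrite /root !hornerE e.
  by rewrite !rpredD ?rpred1 ?rpredX ?polyOverX.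
rewrite -addrA -size_poly_gt0 size_polyDl size_polyXn //.
by rewrite (leq_ltn_trans (size_polyD _ _)) // size_polyX size_poly1.
Qed.

Let T_succ_neq i s : T i (s + 1) != T i s.
Proof.
have [nz ->] := T_step i s; apply: contra (T_quad i s) => /eqP e.
have /eqP : (T i s + 1) * T i s = - 1 by rewrite -{2}e mulrN divff.
by rewrite -addr_eq0 => /eqP e1; apply/eqP; rewrite -[RHS]e1; ring.
Qed.

Let T_inj i : injective (T i).
Proof.
have n10 := T_succ_neq i 0; have n21 := T_succ_neq i 1; have n02 := T_succ_neq i 2%:R.
rewrite !add0r in n10; have e2 : 1 + 1 = 2%:R :> 'Z_3 by [].
have e3 : 2%:R + 1 = 0 :> 'Z_3 by apply: val_inj.
rewrite e2 in n21; rewrite e3 in n02.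
by apply: Z3P => [||]; apply: Z3P => // /eqP; rewrite ?(negPf n10) ?(negPf n21)
  ?(negPf n02) // eq_sym ?(negPf n10) ?(negPf n21) ?(negPf n02).
Qed.

Let T_neq i l s t : i != l -> T i s - T l t != 0.
Proof.
move=> neq; rewrite subr_eq0; apply/eqP=> e; apply: (T_free (i := i) (s := s)).
rewrite e; apply: gen_alg.
have ot r : tau l r \in genfield (others (inl (i, s))).
  by apply: X_other; apply: contraNneq neq => -[->].
by rewrite rpred_div ?rpredB.
Qed.

Let jj i := \sum_s T i s.

(** The simplest cubics: the second and third elementary symmetric functions of
    an orbit of [Z |-> - 1 / (Z + 1)] are determined by the first one. *)
Let T_poly i : \prod_(z <- [:: T i 0; T i 1; T i 2%:R]) ('X - z%:P)
  = 'X^3 - (jj i)%:P * 'X^2 - (jj i + 3%:R)%:P * 'X - 1.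
Proof.
rewrite !big_cons big_nil mulr1 /jj Z3sum.
have [nz0 D1] := T_step i 0; have [nz1 D2] := T_step i 1.
rewrite !add0r in D1; rewrite (_ : 1 + 1 = 2%:R) // in D2.
move: nz0 nz1; rewrite D2 D1; move: (T i 0) => p nz0 nz1.
have nzp : p != 0.
  by apply: contraNneq nz1 => ->; rewrite add0r invr1 addNr.
pose q := - (p + 1)^-1; have Dr : - (- (p + 1)^-1 + 1)^-1 = - (p + 1) / p.
  have -> : - (p + 1)^-1 + 1 = p / (p + 1) by field.
  by rewrite invf_div mulNr.
rewrite Dr; pose r := - (p + 1) / p; rewrite -/q -/r.
have e2 : p * q + p * r + q * r = - (p + q + r + 3%:R).
  by rewrite /r /q; field; rewrite nz0 nzp.
have e3 : p * q * r = 1 by rewrite /r /q; field; rewrite nz0 nzp.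
transitivity ('X^3 - (p + q + r)%:P * 'X^2 + (p * q + p * r + q * r)%:P * 'X - (p * q * r)%:P).
  by rewrite !rmorphD !rmorphM /=; ring.
by rewrite e2 e3 rmorphN /= mulNr.
Qed.

Let v j := d j 0 ^+ 2.
Let sg (s : 'Z_2) : E := if s == 0 then 1 else -1.

Let d_sg j s : d j s = sg s * d j 0.
Proof.
move: s; apply: Z2P; rewrite /sg /= ?mul1r // mulN1r /d !add0r.
by rewrite (_ : 1 + 1 = 0 :> 'Z_2) ?opprB //; apply: val_inj.
Qed.

Let sg_sqr s : sg s ^+ 2 = 1.
Proof. by rewrite /sg; case: ifP; rewrite ?expr1n // sqrrN expr1n. Qed.

Let sgD s t : sg (s + t) = sg s * sg t.
Proof.
by move: s t; apply: Z2P; apply: Z2P; rewrite /sg /= ?mulrNN ?mulr1 ?mul1r.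
Qed.

Let d_nz j : d j 0 != 0.
Proof. by apply: X_neq; apply: contraNneq (oner_neq0 'Z_2) => -[]. Qed.

Let v_inj : injective v.
Proof.
move=> j l /eqP; rewrite eqf_sqr => e; apply/eqP/negPn/negP => neq.
have ot s : eta l s \in genfield (others (inr (j, 0))).
  by apply: X_other; apply: contraNneq neq => -[->].
have o1 : eta j 1 \in genfield (others (inr (j, 0))).
  by apply: X_other; apply/eqP=> -[].
case/negP: (X_notin (inr (j, 0))); rewrite -/(eta j 0).
have -> : eta j 0 = d j 0 + eta j 1 by rewrite /d add0r subrK.
by rewrite rpredD //; case/orP: e => /eqP->; rewrite ?rpredN rpredB.
Qed.

Let A_d0 u j : A u (d j 0) = sg (wbase u.2 j) * d (wtop u.2 j) 0.
Proof. by rewrite A_d add0r d_sg. Qed.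

Let A_v u j : A u (v j) = v (wtop u.2 j).
Proof. by rewrite rmorphXn /= A_d0 exprMn sg_sqr mul1r. Qed.

Let p := \prod_j d j 0.

Let A_p u : \sum_(j < 12) (wbase u.2 j : 'Z_2) = 0 -> A u p = p.
Proof.
move=> su; rewrite rmorph_prod (eq_bigr _ (fun j _ => A_d0 u j)) big_split /=.
have <- : sg (\sum_(j < 12) (wbase u.2 j : 'Z_2)) = \prod_j sg (wbase u.2 j).
  exact: big_morph.
rewrite su /sg eqxx mul1r /p [RHS](reindex_inj (@perm_inj _ (wtop u.2))) //.
Qed.

Let p_sqr : p ^+ 2 = \prod_j v j.
Proof. by rewrite -prodrXl. Qed.

Let V := \prod_j ('X - (v j)%:P).

Let A_V u : map_poly (A u) V = V.
Proof.
rewrite rmorph_prod [RHS](reindex_inj (@perm_inj _ (wtop u.2))) /=.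
by apply: eq_bigr => j _; rewrite rmorphB /= map_polyX map_polyC /= A_v.
Qed.

Let A_jj u i : A u (jj i) = jj (wtop u.1 i).
Proof.
rewrite rmorph_sum [RHS](reindex_inj (addIr (wbase u.1 i))) /=.
by apply: eq_bigr => s _; rewrite A_T.
Qed.

Let xE i := iota (x i).
Let aE := iota a.
Let bE := iota b.

Let A_xE u i : A u (xE i) = xE (wtop u.1 i).
Proof. by rewrite A_iota; case: (actE (wtop u.1)) => _ _ ->. Qed.
Let A_aE u : A u aE = aE.
Proof. by rewrite A_iota; case: (actE (wtop u.1)) => -> _ _. Qed.
Let A_bE u : A u bE = bE.
Proof. by rewrite A_iota; case: (actE (wtop u.1)) => _ -> _. Qed.

Let J k := \sum_i jj i * xE i ^+ k.

Let A_J u k : A u (J k) = J k.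
Proof.
rewrite rmorph_sum [RHS](reindex_inj (@perm_inj _ (wtop u.1))) /=.
by apply: eq_bigr => i _; rewrite rmorphM rmorphXn /= A_jj A_xE.
Qed.

(** A square root of the discriminant, on which permutations act by their sign. *)
Let vdm n (z : 'I_n -> E) := \det (Vandermonde n (\row_l z l)).

Let vdm_perm n (z : 'I_n -> E) (s : 'S_n) : vdm (z \o s) = (-1) ^+ s * vdm z.
Proof.
rewrite /vdm; have -> : Vandermonde n (\row_l (z \o s) l) = col_perm s (Vandermonde n (\row_l z l)).
  by apply/matrixP=> i l; rewrite !mxE.
by rewrite col_permE det_mulmx det_perm odd_permV mulrC.
Qed.

Let vdm_map n (z : 'I_n -> E) u : A u (vdm z) = vdm (A u \o z).
Proof.
by rewrite /vdm -det_map_mx; congr (\det _); apply/matrixP=> i l; rewrite !mxE rmorphXn.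
Qed.

Let vdm_nz n (z : 'I_n -> E) : injective z -> vdm z != 0.
Proof.
move=> zI; rewrite /vdm det_Vandermonde; apply/prodf_neq0 => i _; apply/prodf_neq0 => l.
by move=> lt; rewrite !mxE subr_eq0 (inj_eq zI) -val_eqE /= gtn_eqF.
Qed.

(** The sign [e] collects the pairs that the double product on the right takes in
    the opposite order. *)
Let vdm_sqr n (z : 'I_n -> E) : exists2 e : E, e ^+ 2 = 1 &
  vdm z ^+ 2 = e * \prod_i \prod_(l | l != i) (z i - z l).
Proof.
rewrite /vdm det_Vandermonde; set D := \prod_(i < n) _.
pose D' := \prod_(i < n) \prod_(l < n | (i < l)%N) (z i - z l).
have DD : D = \prod_(i < n) \prod_(l < n | (i < l)%N) (z l - z i).
  by apply: eq_bigr => i _; apply: eq_bigr => l _; rewrite !mxE.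
have -> : \prod_i \prod_(l | l != i) (z i - z l) = D' * D.
  rewrite DD [X in D' * X](exchange_big_dep xpredT) //= -big_split /=.
  apply: eq_bigr => i _; rewrite (bigID (fun l : 'I_n => (i < l)%N)) /=.
  congr (_ * _); apply: eq_bigl => l.
    by rewrite -val_eqE andbC /=; case: ltngtP.
  by rewrite -val_eqE /=; case: ltngtP.
pose e := \prod_(i < n) \prod_(l < n | (i < l)%N) (-1 : E).
have -> : D' = e * D.
  rewrite DD -big_split; apply: eq_bigr => i _ /=; rewrite -big_split /=.
  by apply: eq_bigr => l _; rewrite mulN1r opprB.
have e2 : e ^+ 2 = 1.
  rewrite -prodrXl big1 // => i _; rewrite -prodrXl big1 // => l _.
  by rewrite sqrrN expr1n.
by exists e => //; rewrite -mulrA mulrA -!expr2 e2 mul1r.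
Qed.

Let D12 := vdm v ^+ 2.

Let DxE : 'X^8 + aE *: 'X + bE%:P = \prod_i ('X - (xE i)%:P).
Proof.
transitivity (map_poly iota ('X^8 + a *: 'X + b%:P)).
  by rewrite !rmorphD /= map_polyXn map_polyZ map_polyX map_polyC.
rewrite Dx rmorph_prod; apply: eq_bigr => i _.
by rewrite rmorphB /= map_polyX map_polyC.
Qed.

Let xE_inj : injective xE. Proof. by move=> i l /fmorph_inj/xI. Qed.

Let ab_free : independent (fun _ => False) [:: aE; bE].
Proof. by apply: (@ind_rmorph _ _ iota (fun _ => False) _ [:: a; b]). Qed.

Let aE_nz : aE != 0.
Proof.
have [na _] := ab_free; apply/eqP=> a0; apply: na; rewrite a0.
exact/gen_alg/rpred0.
Qed.
Let bE_nz : bE != 0.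
Proof.
have [_ [nb _]] := ab_free; apply/eqP=> b0; apply: nb; rewrite b0.
exact/gen_alg/rpred0.
Qed.

(** The discriminant is the product of the derivatives [f'(x)] at the roots, and
    [x f'(x) = - 7 a x - 8 b] there: the product of these linear expressions is
    a value of the trinomial. *)
Let disc8 : exists2 e : E, e ^+ 2 = 1 &
  vdm xE ^+ 2 = e * (8%:R ^+ 8 * bE ^+ 7 - 7%:R ^+ 7 * aE ^+ 8).
Proof.
have [e e2 ->] := vdm_sqr xE; exists e => //; congr (_ * _).
have prodx : \prod_i xE i = bE.
  transitivity (\prod_i ('X - (xE i)%:P)).[0].
    rewrite horner_prod; transitivity (\prod_i (-1 * xE i) : E).
      rewrite big_split /= prodr_const card_ord -signr_odd mul1r //.
    by apply: eq_bigr => i _; rewrite hornerXsubC sub0r mulN1r.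
  by rewrite -DxE !hornerD hornerXn hornerZ hornerX hornerC expr0n mulr0 !add0r.
apply: (mulfI bE_nz); rewrite -{1}prodx -big_split /=.
transitivity (\prod_i ((7%:R * aE) * (- (8%:R * bE) / (7%:R * aE) - xE i))).
  apply: eq_bigr => i _.
  have -> : \prod_(l | l != i) (xE i - xE l) = 8%:R * xE i ^+ 7 + aE.
    transitivity ('X^8 + aE *: 'X + bE%:P)^`().[xE i].
      rewrite DxE [X in X^`()](bigD1 i) //= derivM hornerD !hornerM derivXsubC hornerC mul1r.
      rewrite hornerXsubC subrr mul0r addr0 horner_prod.
      by apply: eq_bigr => l _; rewrite hornerXsubC.
    by rewrite !derivE addr0 hornerD hornerMn hornerXn hornerZ hornerC mulr1 mulr_natl.
  have ax := trinomial_root DxE i; transitivity (- 7%:R * aE * xE i - 8%:R * bE).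
    apply/eqP; rewrite -subr_eq0; apply/eqP.
    transitivity (8%:R * (xE i ^+ 8 + aE * xE i + bE)); first by ring.
    by rewrite ax mulr0.
  by field; rewrite aE_nz nat_nz.
rewrite big_split /= prodr_const card_ord.
have -> : \prod_i (- (8%:R * bE) / (7%:R * aE) - xE i)
        = ('X^8 + aE *: 'X + bE%:P).[- (8%:R * bE) / (7%:R * aE)].
  by rewrite DxE horner_prod; apply: eq_bigr => i _; rewrite hornerXsubC.
rewrite !hornerD hornerXn hornerZ hornerX hornerC.
by field; rewrite aE_nz nat_nz.
Qed.

(** The 22 parameters.  The number [sE = b^7 / a^8], in which the discriminant is
    linear, is not among them: [dl] takes its place, and [cE] and [sE] give back
    [a] and [b]. *)
Let cE := bE / aE.
Let dl := vdm xE * vdm v / aE ^+ 4.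
Let pars : seq E := [:: cE; dl] ++ [seq J k | k : 'I_8] ++ [seq V`_k.+1 | k : 'I_11] ++ [:: p].

Let sE := bE ^+ 7 / aE ^+ 8.

Let D12_nz : D12 != 0. Proof. by rewrite expf_neq0 ?vdm_nz. Qed.

Let sE_gen (S : E -> Prop) : dl ^+ 2 \in genfield S -> D12 \in genfield S -> sE \in genfield S.
Proof.
move=> Sd SD; have [e e2 disc] := disc8.
have Se : e \in genfield S.
  have /orP[/eqP->|/eqP->] : (e == 1) || (e == -1) by rewrite -eqf_sqr e2 expr1n.
    by rewrite rpred1.
  by rewrite rpredN rpred1.
have -> : sE = (e * dl ^+ 2 / D12 + 7%:R ^+ 7) / 8%:R ^+ 8.
  have n8 := nat_nz 7; have De : dl ^+ 2 = e * (8%:R ^+ 8 * sE - 7%:R ^+ 7) * D12.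
    rewrite /dl exprMn exprMn disc -/D12 exprVn -exprM.
    transitivity (e * ((8%:R ^+ 8 * bE ^+ 7 - 7%:R ^+ 7 * aE ^+ 8) / aE ^+ (4 * 2)) * D12).
      by ring.
    congr (_ * _ * _); rewrite /sE; field; exact: aE_nz.
  have nz8 : (8%:R : E) ^+ 8 != 0 by rewrite expf_neq0.
  move: (8%:R ^+ 8) (7%:R ^+ 7) nz8 De => m8 m7 nz8 De.
  transitivity ((e ^+ 2 * (m8 * sE - m7) + m7) / m8).
    by rewrite e2 mul1r subrK mulrC mulKf.
  by rewrite De; field; rewrite nz8 D12_nz.
have Sn n : n%:R \in genfield S by rewrite rpredMn ?rpred1.
by rewrite rpred_div ?rpredX // rpredD ?rpredX // rpred_div // rpredM.
Qed.

Let ab_gen (S : E -> Prop) : cE \in genfield S -> sE \in genfield S ->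
  aE \in genfield S /\ bE \in genfield S.
Proof.
move=> Sc Ss; have Da : aE = cE ^+ 7 / sE.
  by rewrite /cE /sE; field; rewrite aE_nz bE_nz.
have Sa : aE \in genfield S by rewrite Da rpred_div ?rpredX.
have Db : bE = cE * aE by rewrite /cE divfK.
by split=> //; rewrite Db rpredM.
Qed.

Let V_size : size V = 13.
Proof. by rewrite size_prod_XsubC -sum1_size sum1_card card_ord. Qed.

Let V_over (S : E -> Prop) : (forall k : 'I_11, V`_k.+1 \in genfield S) ->
  p ^+ 2 \in genfield S -> V \is a polyOver (genfield S).
Proof.
move=> SV Sp; apply/polyOverP => -[|k].
  rewrite -horner_coef0 horner_prod.
  rewrite (_ : \prod_i _ = p ^+ 2) // p_sqr.
  transitivity (\prod_i (-1 * v i)).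
    by apply: eq_bigr => i _; rewrite hornerXsubC sub0r mulN1r.
  by rewrite big_split /= prodr_const card_ord -signr_odd mul1r.
have [lt|] := ltnP k 11; first exact: (SV (Ordinal lt)).
rewrite leq_eqVlt => /predU1P[<-|lt]; last by rewrite nth_default ?rpred0 // V_size.
have /monicP : V \is monic by apply: monic_prod_XsubC.
by rewrite lead_coefE V_size /= => ->; rewrite rpred1.
Qed.

Let D12_gen (S : E -> Prop) : (forall j, v j \in genfield S) -> D12 \in genfield S.
Proof.
move=> Sv; rewrite rpredX // /vdm det_Vandermonde rpred_prod // => i _.
by rewrite rpred_prod // => l _; rewrite !mxE rpredB.
Qed.

Let parsP (P : E -> Prop) : (forall z, z \in pars -> P z) <->
  [/\ P cE, P dl, forall k : 'I_8, P (J k), forall k : 'I_11, P V`_k.+1 & P p].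
Proof.
split=> [Pp|[Pc Pd PJ PV Pp] z].
  split=> [||k|k|]; apply: Pp; rewrite !mem_cat ?mem_seq1 ?inE ?eqxx ?orbT //.
    by rewrite (image_f (fun k : 'I_8 => J k)) ?orbT.
  by rewrite (image_f (fun k : 'I_11 => V`_k.+1)) ?orbT.
rewrite !mem_cat !inE -!orbA => /or4P[/eqP->|/eqP->|/imageP[k _ ->]|] //.
by case/orP=> [/imageP[k _ ->]|/eqP->].
Qed.

(** The location and the scale of the variables of each corner, and the location
    of those of each edge, which [T] and [d] forget. *)
Let extra : seq E := [seq \sum_s tau i s | i : 'I_8]
  ++ [seq tau i 1 - tau i 2%:R | i : 'I_8] ++ [seq eta j 0 + eta j 1 | j : 'I_12].

Let alg_pars z : z \in [:: aE; bE] ++ [seq X c | c : facelet] ->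
  algebraic_over (adjoins (fun _ => False) (pars ++ extra)) z.
Proof.
set S := adjoins _ _.
have [] : [/\ cE \in genfield (algebraic_over S), dl \in genfield (algebraic_over S),
    forall k : 'I_8, J k \in genfield (algebraic_over S),
    forall k : 'I_11, V`_k.+1 \in genfield (algebraic_over S) & p \in genfield (algebraic_over S)].
  apply: (proj1 (parsP (fun z => z \in genfield (algebraic_over S)))) => w wp.
  by apply/genW/in_alg_gen/adjsE; right; rewrite mem_cat wp.
move=> Gc Gd GJ GV Gp.
have Ge w : w \in extra -> w \in genfield (algebraic_over S).
  by move=> we; apply/genW/in_alg_gen/adjsE; right; rewrite mem_cat we orbT.
have Gv j : v j \in genfield (algebraic_over S).
  apply/genW/(alg_root (q := V)).
  - by apply: V_over; rewrite ?rpredX.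
  - by rewrite -size_poly_gt0 V_size.
  - by rewrite /V (bigD1 j) //= rootM root_XsubC eqxx.
have Gd0 j : d j 0 \in genfield (algebraic_over S).
  apply/genW/(alg_root (q := 'X^2 - (v j)%:P)).
  - by rewrite rpredB ?rpredX ?polyOverX ?polyOverC.
  - by rewrite -size_poly_gt0 size_XnsubC.
  - by rewrite /root !hornerE subrr.
have [Ga Gb] : aE \in genfield (algebraic_over S) /\ bE \in genfield (algebraic_over S).
  by apply: ab_gen => //; apply: sE_gen; [apply: rpredX | apply: D12_gen].
have Gx i : xE i \in genfield (algebraic_over S).
  apply/genW/(alg_root (q := 'X^8 + aE *: 'X + bE%:P)).
  - by rewrite !rpredD ?rpredX ?polyOverX ?polyOverC ?polyOverZ ?polyOverX.
  - rewrite -size_poly_gt0 -addrA size_polyDl size_polyXn //.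
    rewrite (leq_ltn_trans (size_polyD _ _)) // gtn_max size_polyC.
    by rewrite (leq_ltn_trans (size_scale_leq _ _)) ?size_polyX //; case: eqP.
  - by rewrite DxE (bigD1 i) //= rootM root_XsubC eqxx.
have Gj i : jj i \in genfield (algebraic_over S) by apply: weights_in_genp xE_inj Gx GJ.
have GT i : T i 0 \in genfield (algebraic_over S).
  apply/genW/(alg_root (q := \prod_(z <- [:: T i 0; T i 1; T i 2%:R]) ('X - z%:P))).
  - have Gj3 : jj i + 3%:R \in genfield (algebraic_over S) by rewrite rpredD ?rpred_nat.
    by rewrite T_poly !(rpredB, rpredM, rpredX, rpred1, polyOverX, polyOverC).
  - by rewrite monic_neq0 // monic_prod_XsubC.
  - by rewrite root_prod_XsubC mem_head.
have Gtau i : forall s, tau i s \in genfield (algebraic_over S).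
  have n3 := nat_nz 2.
  have e1 : \sum_s tau i s \in genfield (algebraic_over S).
    by apply: Ge; rewrite !mem_cat (image_f (fun i => \sum_s tau i s)).
  have e2 : tau i 1 - tau i 2%:R \in genfield (algebraic_over S).
    by apply: Ge; rewrite !mem_cat (image_f (fun i => tau i 1 - tau i 2%:R)) ?orbT.
  have e0 : tau i 0 - tau i 1 \in genfield (algebraic_over S).
    have -> : tau i 0 - tau i 1 = T i 0 * (tau i 1 - tau i 2%:R).
      by rewrite /T !add0r divfK // tau_neq.
    by rewrite rpredM.
  have t1 : tau i 1 \in genfield (algebraic_over S).
    have -> : tau i 1 = (\sum_s tau i s - (tau i 0 - tau i 1) + (tau i 1 - tau i 2%:R)) / 3%:R.
      by rewrite Z3sum; field.
    apply: rpred_div; last exact: rpred_nat.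
    by apply: rpredD => //; apply: rpredB.
  apply: Z3P => //; first by rewrite -(subrK (tau i 1) (tau i 0)) rpredD.
  by rewrite -(subKr (tau i 1) (tau i 2%:R)) rpredB.
have Geta j : forall s, eta j s \in genfield (algebraic_over S).
  have n2 := nat_nz 1; have := Gd0 j; rewrite /d add0r => e0.
  have e1 : eta j 0 + eta j 1 \in genfield (algebraic_over S).
    by apply: Ge; rewrite !mem_cat (image_f (fun i => eta i 0 + eta i 1)) ?orbT.
  have t0 : eta j 0 \in genfield (algebraic_over S).
    have -> : eta j 0 = ((eta j 0 + eta j 1) + (eta j 0 - eta j 1)) / 2%:R by field.
    by apply: rpred_div; [apply: rpredD | apply: rpred_nat].
  apply: Z2P => //.
  by rewrite -(subKr (eta j 0) (eta j 1)) rpredB.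
rewrite mem_cat !inE -orbA => zin; apply: alg_genp; case/or3P: zin => [/eqP->|/eqP->|] //.
by case/imageP=> -[[i s]|[j s]] _ ->; [apply: Gtau | apply: Geta].
Qed.

Let pars_size : size pars = 22.
Proof. by rewrite !size_cat !size_image !card_ord. Qed.

Let pars_ind : independent (fun _ => False) pars.
Proof.
apply: (@ind_sub _ _ _ extra); apply: ind_steinitz alg_pars.
  by rewrite !size_cat !size_image card_sum !card_prod !card_ord.
apply: ind_cat; first exact: ab_free.
apply: (ind_anti (S := fun z => exists c, z = iota c)).
  by move=> z /adjsE[//|]; rewrite !inE => /orP[/eqP->|/eqP->]; apply: in_alg_gen;
    [exists a | exists b].
apply: ind_free; last exact: enum_uniq.
exact: X_free.
Qed.

(** The invariants of the pairs for which the edge orientations sum to zero,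
    whatever the signs. *)
Let S0 z := z = aE \/ z = bE \/ (exists k : 'I_8, z = J k) \/
  (exists k : 'I_11, z = V`_k.+1) \/ z = p.
Let even_fixed e := forall u : cube, \sum_(j < 12) (wbase u.2 j : 'Z_2) = 0 -> A u e = e.

Let S0_fixed z : S0 z -> even_fixed z.
Proof.
case=> [->|[->|[[k ->]|[[k ->]|->]]]] u u0.
- exact: A_aE.
- exact: A_bE.
- exact: A_J.
- by rewrite -[in RHS](A_V u) coef_map.
- exact: A_p.
Qed.

Let Sx z := S0 z \/ exists i, z = xE i.
Let Sv z := Sx z \/ exists j, z = v j.
Let Sd n z := Sv z \/ exists2 j : 'I_12, (j < n)%N & z = d j 0.
Let St n z := Sd 12 z \/ exists2 i : 'I_8, (i < n)%N & z = T i 0.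

Let S0_V : V \is a polyOver (genfield S0).
Proof.
apply: V_over => [k|]; first by apply: genW; do 3!right; left; exists k.
by rewrite rpredX //; apply: genW; do 4!right.
Qed.

Let Sx_V : V \is a polyOver (genfield Sx).
Proof. by apply: polyOverS S0_V; apply: genp_mono => w Sw; apply: genW; left. Qed.

Let Sx_jj i : jj i \in genfield Sx.
Proof.
apply: (weights_in_genp _ xE_inj) => [l|k]; apply: genW; first by right; exists l.
by left; do 2!right; left; exists k.
Qed.

Let twist (n : 'I_8) (s : 'Z_3) : cube :=
  (Wreath _ [ffun i => if i == n then s else 0 : 'Z_3] 1%g, 1%g).

(** Twisting the corner [n] alone permutes the [T n s] cyclically and fixes the
    other generators. *)
Let descend_T n e : (n <= 8)%N -> even_fixed e -> e \in genfield (St n) -> e \in genfield (St 0).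
Proof.
move=> le8 fe; elim: n le8 => // n IHn lt Se; apply: (IHn (ltnW lt)); pose i := Ordinal lt.
have Sj : jj i \in genfield (St n).
  by apply: genp_mono (Sx_jj i) => w Sw; apply: genW; do 3!left.
apply: (@gen_descend _ _ (T i 0) [:: T i 0; T i 1; T i 2%:R]).
- by rewrite /= !inE !(inj_eq (@T_inj i)).
- exact: mem_head.
- have Sj3 : jj i + 3%:R \in genfield (St n) by rewrite rpredD ?rpred_nat.
  by rewrite T_poly !(rpredB, rpredM, rpredX, rpred1, polyOverX, polyOverC).
- apply: genp_mono Se => w [Sw|[l]]; first by apply: genW; left; left.
  rewrite ltnS leq_eqVlt => /predU1P[eq ->|lt' ->].
    by apply: genW; right; congr (T _ 0); apply: val_inj.
  by apply: genW; left; right; exists l.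
have tw s : [/\ forall w, St n w -> A (twist i s) w = w, A (twist i s) (T i 0) = T i s
    & A (twist i s) e = e].
  have s0 : \sum_(j < 12) (wbase (twist i s).2 j : 'Z_2) = 0.
    by rewrite big1 // => j _; rewrite ffunE.
  split; last exact: fe; last by rewrite A_T /= perm1 ffunE eqxx add0r.
  move=> _ [[[[/S0_fixed-> //|[l ->]]|[j ->]]|[j _ ->]]|[l ltl ->]].
  - by rewrite A_xE perm1.
  - by rewrite A_v perm1.
  - by rewrite A_d /= perm1 ffunE addr0.
  - by rewrite A_T /= perm1 ffunE -val_eqE /= ltn_eqF ?addr0.
move=> y; rewrite !inE => /or3P[] /eqP ->; [exists (A (twist i 0)) |
  exists (A (twist i 1)) | exists (A (twist i 2%:R))]; exact: tw.
Qed.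

(** The sum of the edge orientations has to remain zero, so the last edge is
    flipped too; [d ord_max 0] is not among the generators of [Sd 11]. *)
Let flip (n : 'I_12) : cube :=
  (1%g, Wreath _ [ffun j => if (j == n) || (j == ord_max) then 1 else 0 : 'Z_2] 1%g).

Let descend_d n e : (n <= 11)%N -> even_fixed e -> e \in genfield (Sd n) -> e \in genfield Sv.
Proof.
move=> le11 fe; elim: n le11 => [_|n IHn lt Se].
  by apply: genp_mono => w [Sw|[j]] //; apply: genW.
apply: (IHn (ltnW lt)); pose j := widen_ord (leqnSn 11) (Ordinal lt).
have d_neq : d j 0 != - d j 0.
  by rewrite -subr_eq0 opprK -mulr2n -mulr_natl mulf_neq0.
apply: (@gen_descend _ _ (d j 0) [:: d j 0; - d j 0]).
- by rewrite /= inE d_neq.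
- exact: mem_head.
- rewrite !big_cons big_nil mulr1 rmorphN opprK -subr_sqr -rmorphXn.
  rewrite rpredB ?rpredX ?polyOverX // polyOverC; apply: genW.
  by left; right; exists j.
- apply: genp_mono Se => w [Sw|[l]]; first by apply: genW; left; left.
  rewrite ltnS leq_eqVlt => /predU1P[eq ->|lt' ->].
    by apply: genW; right; congr (d _ 0); apply: val_inj.
  by apply: genW; left; right; exists l.
have jm : j != ord_max by rewrite -val_eqE /= ltn_eqF.
move=> y; rewrite !inE => /orP[] /eqP ->.
  exists idfun; split=> //.
have s0 : \sum_(j0 < 12) (wbase (flip j).2 j0 : 'Z_2) = 0.
  rewrite (bigD1 j) //= (bigD1 ord_max) 1?eq_sym //= !ffunE !eqxx orbT.
  rewrite big1 ?addr0; first exact: val_inj.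
  by move=> l /andP[lj lm]; rewrite ffunE (negPf lj) (negPf lm).
exists (A (flip j)); split; last exact: fe.
  move=> _ [[[/S0_fixed-> //|[l ->]]|[l ->]]|[l ltl ->]].
  - by rewrite A_xE perm1.
  - by rewrite A_v perm1.
  - rewrite A_d /= perm1 ffunE -!val_eqE /= !ltn_eqF ?addr0 //.
    exact: ltn_trans ltl lt.
by rewrite A_d0 /= perm1 ffunE eqxx /sg /= mulN1r.
Qed.

(** After the [T] and the [d], symmetric functions descend first in the [v j] and
    then in the roots of the trinomial; [d ord_max 0] is the quotient of [p] by the
    other [d j 0]. *)
Let fixed_S0 e : even_fixed e -> e \in genfield (St 8) -> e \in genfield S0.
Proof.
move=> fe /(descend_T (leqnn 8) fe) Se.
have {}Se : e \in genfield Sv.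
  apply: (descend_d (leqnn 11)) => //; apply: genp_mono Se => w [[Sw|[j _ ->]]|[//]].
    by apply: genW; left.
  have Sdl (l : 'I_12) : l != ord_max -> d l 0 \in genfield (Sd 11).
    move=> lm; apply: genW; right; exists l => //.
    by rewrite ltn_neqAle -ltnS ltn_ord andbT.
  have [->|] := eqVneq j ord_max; last exact: Sdl.
  have nzd : \prod_(l < 12 | l != ord_max) d l 0 != 0.
    by apply/prodf_neq0 => l _.
  have -> : d ord_max 0 = p / \prod_(l < 12 | l != ord_max) d l 0.
    by rewrite /p (bigD1 ord_max) //= mulfK.
  apply: rpred_div; last exact: rpred_prod.
  by apply: genW; do 3!left; do 4!right.
have {}Se : e \in genfield Sx.
  apply: (gen_symmetric v_inj Sx_V Se) => i j.
  exists (A (1%g, Wreath _ [ffun => 0 : 'Z_2] (tperm i j))); split.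
  - move=> _ [/S0_fixed->//|[l ->]]; first by rewrite big1 // => l _; rewrite ffunE.
    by rewrite A_xE perm1.
  - by move=> k; rewrite A_v.
  - by apply: fe; rewrite big1 // => l _; rewrite ffunE.
apply: (gen_symmetric xE_inj _ Se) => [|i j].
  rewrite -DxE !rpredD ?rpredX ?polyOverX ?polyOverC ?polyOverZ ?polyOverX //.
    by apply: genW; left.
  by apply: genW; right; left.
have s0 : \sum_(l < 12) (wbase (1%g : Zwr 2 12) l : 'Z_2) = 0.
  by rewrite big1 // => l _; rewrite ffunE.
exists (A (Wreath _ [ffun => 0 : 'Z_3] (tperm i j), 1%g)); split.
- by move=> w /S0_fixed->.
- by move=> k; rewrite A_xE.
- exact: fe.
Qed.
Let A_dl u : A u dl = (-1) ^+ (wtop u.1 (+) wtop u.2) * dl.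
Proof.
rewrite fmorph_div rmorphM rmorphXn /= A_aE !vdm_map.
have -> : vdm (A u \o xE) = (-1) ^+ wtop u.1 * vdm xE.
  rewrite -vdm_perm; congr (\det (Vandermonde _ _)); apply/rowP=> l.
  by rewrite !mxE /= A_xE.
have -> : vdm (A u \o v) = (-1) ^+ wtop u.2 * vdm v.
  rewrite -vdm_perm; congr (\det (Vandermonde _ _)); apply/rowP=> l.
  by rewrite !mxE /= A_v.
by rewrite signr_addb /dl -!mulrA (mulrCA (vdm xE)).
Qed.

Let Sp (w : E) : Prop := w \in pars.

Let pars_fixed (u : cube) (z : E) : \sum_(j < 12) (wbase u.2 j : 'Z_2) = 0 ->
  wtop u.1 (+) wtop u.2 = false -> z \in genfield Sp -> A u z = z.
Proof.
move=> u0 u1; apply: (@gen_ext _ _ (A u) idfun) => {z}.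
apply: (proj2 (parsP _)); split=> [||k|k|] /=; last exact: A_p.
- by rewrite fmorph_div /= A_aE A_bE.
- by rewrite A_dl u1 mul1r.
- exact: A_J.
- by rewrite -[in RHS](A_V u) coef_map.
Qed.

(** [D12] is symmetric in the [v j], hence a function of the coefficients of [V]. *)
Let S0_pars : {subset genfield S0 <= genfield Sp}.
Proof.
have [Gc Gd GJ GV Gp] := proj1 (parsP (fun z => z \in genfield Sp))
  (fun z zp => @genW _ Sp z zp).
have GD : D12 \in genfield Sp.
  pose S z := (exists k : 'I_11, z = V`_k.+1) \/ z = p.
  have SV : V \is a polyOver (genfield S).
    by apply: V_over => [k|]; [apply: genW; left; exists k | apply: rpredX; apply: genW; right].
  have SD : D12 \in genfield (fun z => S z \/ exists j, z = v j).
    by apply: D12_gen => j; apply: genW; right; exists j.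
  have : D12 \in genfield S.
    apply: (gen_symmetric v_inj SV SD) => i j.
    pose u : cube := (1%g, Wreath _ [ffun => 0 : 'Z_2] (tperm i j)).
    have u0 : \sum_(l < 12) (wbase u.2 l : 'Z_2) = 0 by rewrite big1 // => l _; rewrite ffunE.
    exists (A u); split=> [w [[k ->]|->]|k|].
    - by rewrite -[in RHS](A_V u) coef_map.
    - exact: A_p.
    - by rewrite A_v.
    - rewrite rmorphXn /= vdm_map /D12.
      have -> : vdm (A u \o v) = (-1) ^+ wtop u.2 * vdm v.
        rewrite -vdm_perm; congr (\det (Vandermonde _ _)); apply/rowP=> l.
        by rewrite !mxE /= A_v.
      by rewrite exprMn sqrr_sign mul1r.
  by apply: genp_mono => z [[k ->]|->].
have [Ga Gb] := ab_gen Gc (sE_gen (rpredX 2 Gd) GD).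
by apply: genp_mono => z [->|[->|[[k ->]|[[k ->]|->]]]].
Qed.

Let cube_fixed e := forall u : cube, \sum_(j < 12) (wbase u.2 j : 'Z_2) = 0 ->
  wtop u.1 (+) wtop u.2 = false -> A u e = e.

Let dl_nz : dl != 0.
Proof. by rewrite !mulf_neq0 ?invr_eq0 ?expf_neq0 ?vdm_nz. Qed.

Let Sm z := (exists c, z = iota c) \/ (exists i s, z = T i s) \/ exists j s, z = d j s.

Let A_Sm u z : z \in genfield Sm -> A u z \in genfield Sm.
Proof.
move=> Sz; apply: genp_rmorph Sz => w [[c ->]|[[i [s ->]]|[j [s ->]]]]; apply: genW.
- by left; exists (act (wtop u.1) c); rewrite A_iota.
- by right; left; rewrite A_T; do 2!eexists.
- by do 2!right; rewrite A_d; do 2!eexists.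
Qed.

Let Sm_St : {subset genfield Sm <= genfield (St 8)}.
Proof.
apply: genp_mono => z [[c ->]|[[i [s ->]]|[j [s ->]]]].
- apply: genp_rmorph (L_gen c) => w [->|[->|[i ->]]]; apply: genW; do 3!left.
  + by left; left.
  + by left; right; left.
  + by right; exists i.
- have ST : T i 0 \in genfield (St 8) by apply: genW; right; exists i.
  have Ss t : T i t \in genfield (St 8) -> T i (t + 1) \in genfield (St 8).
    by move=> St'; have [_ ->] := T_step i t; rewrite rpredN rpredV rpredD ?rpred1.
  have ST1 := Ss _ ST; have ST2 := Ss _ ST1.
  by move: s; apply: Z3P => //; [rewrite add0r in ST1 | rewrite add0r in ST2].
- rewrite d_sg rpredM //; last by apply: genW; left; right; exists j.
  by rewrite /sg; case: ifP => _; rewrite ?rpredN rpred1.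
Qed.

(** With [e1] the image of [e] under an odd element [u1], both [e + e1] and
    [(e - e1) * dl] are invariant under all the pairs for which the edge
    orientations sum to zero, since [dl] changes by the sign. *)
Let fixed_pars e : cube_fixed e -> e \in genfield Sm -> e \in genfield Sp.
Proof.
move=> fe Se; pose u1 : cube := (Wreath _ [ffun => 0 : 'Z_3] (tperm ord0 ord_max), 1%g).
have odd1 : wtop u1.1 (+) wtop u1.2 by rewrite /= odd_tperm odd_perm1.
have sum1 : \sum_(j < 12) (wbase u1.2 j : 'Z_2) = 0.
  by rewrite big1 // => j _; rewrite ffunE.
have sumM (u u' : cube) : \sum_(j < 12) (wbase u.2 j : 'Z_2) = 0 ->
    \sum_(j < 12) (wbase u'.2 j : 'Z_2) = 0 ->
  \sum_(j < 12) (wbase (u * u')%g.2 j : 'Z_2) = 0.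
  by move=> u0 u0'; rewrite wreath_mul_sum u0 u0' addr0.
have signM (u u' : cube) : wtop (u * u')%g.1 (+) wtop (u * u')%g.2
    = (wtop u.1 (+) wtop u.2) (+) (wtop u'.1 (+) wtop u'.2).
  by rewrite !odd_permM addbACA.
have A_odd (u : cube) : \sum_(j < 12) (wbase u.2 j : 'Z_2) = 0 ->
    wtop u.1 (+) wtop u.2 -> A u e = A u1 e.
  move=> u0 uodd; apply: (fmorph_inj (A u1)); rewrite -!A_M !fe ?signM ?odd1 ?uodd //;
  exact: sumM.
pose e1 := A u1 e; have Se1 : e1 \in genfield Sm by apply: A_Sm.
have A_e1 (u : cube) : \sum_(j < 12) (wbase u.2 j : 'Z_2) = 0 ->
    A u e = (if wtop u.1 (+) wtop u.2 then e1 else e) /\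
    A u e1 = (if wtop u.1 (+) wtop u.2 then e else e1).
  move=> u0; rewrite -[A u e1]A_M; case: ifP => [uodd|uev]; split.
  - exact: A_odd.
  - by rewrite fe ?signM ?odd1 ?uodd //; apply: sumM.
  - exact: fe.
  - by rewrite A_odd ?signM ?odd1 ?uev //; apply: sumM.
have Sdl : dl \in genfield Sm.
  have Si c : iota c \in genfield Sm by apply: genW; left; exists c.
  have Sv' j : v j \in genfield Sm by apply: rpredX; apply: genW; do 2!right; do 2!eexists.
  apply: rpred_div; last by apply: rpredX; apply: Si.
  rewrite /vdm !det_Vandermonde; apply: rpredM;
    do 2!(apply: rpred_prod => ? _); rewrite !mxE; apply: rpredB;
    by [apply: Si | apply: Sv'].
have f1 : e + e1 \in genfield S0.
  apply: fixed_S0; last by apply: Sm_St; apply: rpredD.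
  by move=> u u0; have [E1 E2] := A_e1 u u0; rewrite rmorphD /= E1 E2; case: ifP; rewrite 1?addrC.
have f2 : (e - e1) * dl \in genfield S0.
  apply: fixed_S0; last by apply: Sm_St; apply: rpredM => //; apply: rpredB.
  move=> u u0; have [E1 E2] := A_e1 u u0; rewrite rmorphM rmorphB /= E1 E2 A_dl.
  by case: ifP => _; [rewrite expr1 mulN1r mulrN -mulNr opprB | rewrite mul1r].
have n2 := nat_nz 1; have -> : e = (e + e1 + (e - e1) * dl / dl) / 2%:R.
  by rewrite mulfK //; field.
apply: rpred_div; last exact: rpred_nat; apply: rpredD; first exact: S0_pars.
apply: rpred_div; first exact: S0_pars.
by have [] := proj1 (parsP (fun z => z \in genfield Sp)) (fun z zp => @genW _ Sp z zp).
Qed.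

(** * The generator of the extension *)

(** Invariant under the simultaneous rotation of two corners, by the rule
    [T i (s + 1) = - 1 / (T i s + 1)], and injective in its second argument: only
    the difference of the two orientations matters. *)
Let ff (P Q : E) := (P * Q + Q + 1) / (P - Q).

Let A_ff u P Q : A u (ff P Q) = ff (A u P) (A u Q).
Proof. by rewrite fmorph_div rmorphB !rmorphD rmorphM rmorph1. Qed.

Let ff_shift i l s t r : i != l -> ff (T i (s + r)) (T l (t + r)) = ff (T i s) (T l t).
Proof.
move=> neq; have step s' t' : ff (T i (s' + 1)) (T l (t' + 1)) = ff (T i s') (T l t').
  have [nz1 ->] := T_step i s'; have [nz2 ->] := T_step l t'.
  have nz := T_neq s' t' neq; rewrite /ff.
  move: (T i s') (T l t') nz1 nz2 nz => P Q nz1 nz2 nz.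
  have -> : - (P + 1)^-1 - - (Q + 1)^-1 = (P - Q) / ((P + 1) * (Q + 1)).
    by field; rewrite nz1 nz2.
  by field; rewrite nz nz1 nz2.
move: r; apply: Z3P => //; first by rewrite !addr0.
by rewrite (_ : 2%:R = 1 + 1 :> 'Z_3) // !addrA !step.
Qed.

Let ff_inj i l s t t' : i != l -> ff (T i s) (T l t) = ff (T i s) (T l t') -> t = t'.
Proof.
move=> neq; have nz1 := T_neq s t neq; have nz2 := T_neq s t' neq.
have := T_quad i s; have := @T_inj l t t'; rewrite /ff.
move: (T i s) (T l t) (T l t') nz1 nz2 => P Q Q' nz1 nz2 Tinj quad e; apply: Tinj.
apply/eqP; rewrite -subr_eq0; have : (Q - Q') * (P ^+ 2 + P + 1) == 0.
  move/eqP: e; rewrite eqr_div // -subr_eq0 => /eqP e; apply/eqP.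
  by rewrite -[RHS]e; ring.
by rewrite mulf_eq0 (negPf quad) orbF.
Qed.

(** The dummy value at [i == l] lets the index range over all pairs. *)
Let wt (k : 'I_8 + 'I_12 + 'I_8 * 'I_8) : E :=
  match k with
  | inl (inl i) => xE i
  | inl (inr j) => d j 0
  | inr (i, l) => if i == l then 0 else ff (T i 0) (T l 0)
  end.

Let RubikP (u : cube) : u \in Rubik <-> [/\ \sum_(i < 8) (wbase u.1 i : 'Z_3) = 0,
  \sum_(j < 12) (wbase u.2 j : 'Z_2) = 0 & wtop u.1 (+) wtop u.2 = false].
Proof.
split; rewrite !inE /= /rubik_Psi.
  by move=> /eqP[].
by move=> [-> -> ->].
Qed.

(** The roots and the [v j] detect the permutations, the [d j 0] the flips, and the
    [ff] the differences of corner orientations; these are then equal to some [c]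
    with [8 c = 0]. *)
Let wt_faithful u : u \in Rubik -> (forall k, A u (wt k) = wt k) -> u = 1%g.
Proof.
case/RubikP => sum3 _ _ fz.
have top1 : wtop u.1 = 1%g.
  apply/permP=> i; rewrite perm1; apply: xE_inj.
  by rewrite -A_xE; apply: (fz (inl (inl i))).
have fd j : A u (d j 0) = d j 0 := fz (inl (inr j)).
have top2 : wtop u.2 = 1%g.
  apply/permP=> j; rewrite perm1; apply: v_inj.
  by rewrite -A_v rmorphXn /= fd.
have base2 j : wbase u.2 j = 0.
  have := fd j; rewrite A_d0 top2 perm1 => /eqP.
  rewrite -subr_eq0 -{2}[d j 0]mul1r -mulrBl mulf_eq0 (negPf (d_nz j)) orbF.
  rewrite /sg; case: ifP => [/eqP-> //|_]; rewrite -oppr_eq0 opprB opprK.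
  by rewrite -mulr2n (negPf (nat_nz 1)).
have base1 i : wbase u.1 i = wbase u.1 ord0.
  have [->//|neq] := eqVneq i ord0.
  have := fz (inr (i, ord0)); rewrite /= (negPf neq) => e.
  have : ff (T i (wbase u.1 i)) (T ord0 (wbase u.1 ord0)) = ff (T i 0) (T ord0 0).
    by rewrite -[RHS]e A_ff !A_T top1 !perm1 !add0r.
  rewrite -(ff_shift 0 0 (wbase u.1 i) neq) add0r.
  by move=> /(ff_inj neq)->.
have base0 : wbase u.1 ord0 = 0.
  move: sum3; rewrite (eq_bigr _ (fun i _ => base1 i)) sumr_const card_ord.
  by move: (wbase u.1 ord0); apply: Z3P.
clear fz fd sum3; case: u => [[b1 t1] [b2 t2]] /= in top1 top2 base1 base2 base0 *.
congr (_, _).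
  by rewrite top1; congr Wreath; apply/ffunP=> i; rewrite base1 base0 ffunE.
by rewrite top2; congr Wreath; apply/ffunP=> j; rewrite base2 ffunE.
Qed.

Let rot (c : 'Z_3) : cube := (Wreath _ [ffun => c] 1%g, 1%g).

Let rot_central c u : (u * rot c = rot c * u)%g.
Proof.
case: u => [[b1 t1] [b2 t2]]; congr (_, _); last by rewrite mulg1 mul1g.
congr Wreath; last by rewrite /= mulg1 mul1g.
apply/ffunP=> i; rewrite /= !ffunE act1; exact: addrC.
Qed.

Let rot_wt c k : A (rot c) (wt k) = wt k.
Proof.
case: k => [[i|j]|[i l]] /=.
- by rewrite A_xE perm1.
- by rewrite A_d /= perm1 ffunE addr0.
- case: eqP => [_|/eqP neq]; first by rewrite rmorph0.
  rewrite A_ff !A_T /= !perm1 !ffunE.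
  exact: ff_shift.
Qed.

Variable q : {rmorphism rat -> L}.

(** An element of the field of the orbit that [Rubik] fixes is also fixed by the
    rotations, which are central and fix [z]; so it is one of the invariants that
    [fixed_pars] describes. *)
Theorem rubik_galois_extension :
  exists L' : splittingFieldType {fraction {mpoly rat[22%N]}},
    galois 1%AS {:L'} /\ 'Gal({:L'} / 1)%G \isog Rubik.
Proof.
have [io [io_in io_onto]] := frac_mpoly_embedding (iota \o q) pars_size pars_ind.
have [m zP] := primitive_combination A wt ch0.
set z := \sum_i _ in zP.
have Sz : z \in genfield Sm.
  apply: rpred_sum => k _; apply: rpredM; last by apply: rpredX; apply: rpred_nat.
  have ST i s : T i s \in genfield Sm by apply: genW; right; left; do 2!eexists.
  case: k => [[i|j]|[i l]] /=.
  - by apply: genW; left; eexists.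
  - by apply: genW; do 2!right; do 2!eexists.
  - case: ifP => _; first exact: rpred0.
    apply: rpred_div; last exact: rpredB.
    by apply: rpredD; [apply: rpredD => //; exact: rpredM | exact: rpred1].
have rot_z c : A (rot c) z = z.
  rewrite rmorph_sum; apply: eq_bigr => k _.
  by rewrite rmorphM rmorphXn rmorph_nat /= rot_wt.
apply: (@artin_galois _ _ io _ Rubik A z).
- by move=> g h _ _ e; rewrite A_M.
- move=> g c /RubikP[_ g2 g3]; exact: pars_fixed.
- move=> e Se fe; apply: io_onto; apply: fixed_pars.
    have rot_e c : A (rot c) e = e.
      apply: (gen_ext (g := idfun) _ Se) => _ [g _ ->] /=.
      by rewrite -A_M rot_central A_M rot_z.
    (* [u * rot c] is in the Rubik group, as [c + 8 c = 0]. *)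
    move=> u u2 u3; pose c := \sum_(i < 8) (wbase u.1 i : 'Z_3).
    apply: (fmorph_inj (A (rot c))); rewrite -A_M rot_e fe //; apply/RubikP; split.
    + rewrite wreath_mul_sum -/c (eq_bigr (fun _ => c)) => [|i _]; last by rewrite ffunE.
      by rewrite sumr_const card_ord; move: c; apply: Z3P; apply: val_inj.
    + by rewrite wreath_mul_sum u2 big1 ?addr0 // => j _; rewrite ffunE.
    + by rewrite /= !mulg1.
  apply: genp_mono Se => _ [g _ ->]; exact: A_Sm.
- by move=> g Rg gz; apply: wt_faithful (zP _ gz).
Qed.
End RubikField.

Theorem theorem2 :
  exists n : nat, (1 <= n)%N /\
  exists L : splittingFieldType {fraction {mpoly rat[n]}},
    galois 1%AS {:L} /\ 'Gal({:L} / 1)%G \isog Rubik.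
Proof.
have [L [q [a [b [x [act [ab_ind Dx xI L_gen actE]]]]]]] := trinomial_symmetric.
have ch0L : [pchar L] =i pred0.
  by move=> i; rewrite (fmorph_pchar q) Num.Theory.pchar_num.
have [E [iota [X [X_free E_gen X_perm]]]] := generic_variables facelet ch0L.
have ch0E : [pchar E] =i pred0 by move=> i; rewrite (fmorph_pchar iota) ch0L.
have [A [A_iota A_X A_M]] := cube_automorphisms L_gen actE E_gen X_perm.
exists 22; split=> //.
exact: (rubik_galois_extension ab_ind Dx xI L_gen actE ch0E X_free A_iota A_X A_M q).
Qed.
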